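(* Let $\Phi : J_q(E)\to F_0$ be a bundle map with kernel $R_q$, let $\rho_r(\Phi):J_{q+r}(E)\to J_r(F_0)$ be its prolongations, let $Q_r=\mathrm{coker}(\rho_r(\Phi))$ with canonical projection $\Psi_r : J_r(F_0)\to Q_r$, and let $B_r=\mathrm{im}(\rho_r(\Phi))\subseteq J_r(F_0)$. Then for every $r\geq 0$ one has $$B_{r+1}=\mathrm{im}(\rho_{r+1}(\Phi))=\ker(\Psi_{r+1})\subseteq \ker(\rho_1(\Psi_r))=\rho_1(B_r),$$ where $\rho_1(\Psi_r): J_{r+1}(F_0)\to J_1(Q_r)$ is the first prolongation of $\Psi_r$ and $\rho_1(B_r)=J_1(B_r)\cap J_{r+1}(F_0)\subset J_1(J_r(F_0))$ is the first prolongation of the system $B_r$. (In general only the inclusion, not equality, holds in the middle.)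
   Context: $X$ is a manifold of dimension $n$, with cotangent bundle $T^*$; $E$ and $F_0$ are vector bundles over $X$; $J_k(E)$ is the bundle of $k$-jets of sections of $E$. One uses the canonical inclusions $J_{q+r}(E)\subset J_r(J_q(E))$ and $J_{r+1}(F_0)\subset J_1(J_r(F_0))$. Given a vector bundle map $\Phi:J_q(E)\to F_0$ over $X$, set $R_q=\ker(\Phi)$. Its $r$-prolongation is the composite $\rho_r(\Phi): J_{q+r}(E)\hookrightarrow J_r(J_q(E))\xrightarrow{J_r(\Phi)} J_r(F_0)$, with $\rho_0(\Phi)=\Phi$, and $R_{q+r}=\ker(\rho_r(\Phi))$. Let $\pi^{q+r+s}_{q+r}:J_{q+r+s}(E)\to J_{q+r}(E)$ be the canonical projections and $R^{(s)}_{q+r}=\pi^{q+r+s}_{q+r}(R_{q+r+s})$. Standing regularity assumption: $R_{q+r}$ and $R^{(s)}_{q+r}$ are vector bundles for all $r,s\geq 0$. The map $\rho_1(\Psi_r)$ is the composite $J_{r+1}(F_0)\hookrightarrow J_1(J_r(F_0))\xrightarrow{J_1(\Psi_r)} J_1(Q_r)$. *)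

(* Defs.v *)
From HB Require Import structures.
From mathcomp Require Import all_boot all_order all_algebra.
From mathcomp Require Import all_classical all_reals all_analysis.
Set Implicit Arguments.
Unset Strict Implicit.
Unset Printing Implicit Defensive.
Import Order.TTheory GRing.Theory Num.Theory.
Import numFieldNormedType.Exports.
Local Open Scope classical_set_scope.
Local Open Scope ring_scope.

(* Subquotients <S> / (<S> `&` <N>) of a module, as types of cosets of <N>.   *)
(* Taking linear spans makes the construction total; [lspan_id] shows that    *)
(* they change nothing when S and N are already submodules.                   *)

Section Span.
Context {R : realType} {V : lmodType R}.
Implicit Types (A W : set V) (u v : V).

Definition submodule W := W 0 /\ forall a u v, W u -> W v -> W (a *: u + v).

Definition lspan A : set V :=
  [set v | forall W, submodule W -> A `<=` W -> W v].

Lemma sub_lspan A : A `<=` lspan A.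
Proof. by move=> v Av W _; apply. Qed.

Lemma lspan_submodule A : submodule (lspan A).
Proof.
split=> [W [W0 _] _ //|a u v uA vA W sW AW].
by apply: (sW.2); [exact: uA | exact: vA].
Qed.

Lemma lspan_id W : submodule W -> lspan W = W.
Proof.
by move=> sW; apply/seteqP; split=> [v|]; [apply | exact: sub_lspan].
Qed.

Lemma lspan0 A : lspan A 0.
Proof. exact: (lspan_submodule A).1. Qed.

Lemma lspanD A u v : lspan A u -> lspan A v -> lspan A (u + v).
Proof. by move=> uA vA; rewrite -[u]scale1r; apply: (lspan_submodule A).2. Qed.

Lemma lspanZ A a u : lspan A u -> lspan A (a *: u).
Proof.
by move=> uA; rewrite -[_ *: _]addr0; apply: (lspan_submodule A).2 => //; exact: lspan0.
Qed.

Lemma lspanN A u : lspan A u -> lspan A (- u).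
Proof. by move=> uA; rewrite -scaleN1r; exact: lspanZ. Qed.

End Span.

Section Subquotient.
Context {R : realType} {V : lmodType R}.
Variables S N : set V.

Definition coset (v : V) : set V := [set w | lspan N (w - v)].

Definition subquot : Type :=
  {C : set V | `[< exists2 v, lspan S v & C = coset v >]}.

Lemma coset_eq u v : coset u = coset v <-> lspan N (u - v).
Proof.
split=> [uv|uv].
  have : coset u u by rewrite /coset /= subrr; exact: lspan0.
  by rewrite uv.
apply/seteqP; split=> w; rewrite /coset /= => wu.
  by rewrite -(subrKA u w); apply: lspanD.
by rewrite -(subrKA v w) -(opprB u); apply: lspanD => //; apply: lspanN.
Qed.

Definition qrepr (C : subquot) : V := sval (cid2 (asboolW (valP C))).

Lemma qrepr_lspan C : lspan S (qrepr C).
Proof. by rewrite /qrepr; case: cid2. Qed.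

Lemma qrepr_coset C : val C = coset (qrepr C).
Proof. by rewrite /qrepr; case: cid2. Qed.

Definition subquot0 : subquot :=
  exist _ (coset 0) (asboolT (ex_intro2 _ _ 0 (@lspan0 _ _ S) erefl)).

(* The qclass of v, meaningful for v in <S> only. *)
Definition qclass (v : V) : subquot := insubd subquot0 (coset v).

Lemma val_qclass v : lspan S v -> val (qclass v) = coset v.
Proof. by move=> Sv; rewrite val_insubd asboolT //; exists v. Qed.

Lemma qclassP u v : lspan S u -> lspan S v -> qclass u = qclass v <-> lspan N (u - v).
Proof.
move=> Su Sv; rewrite -coset_eq -!val_qclass //.
by split=> [->//|]; exact: val_inj.
Qed.

Lemma qreprK C : qclass (qrepr C) = C.
Proof.
by apply: val_inj; rewrite val_qclass -?qrepr_coset //; exact: qrepr_lspan.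
Qed.

Lemma qrepr_qclass v : lspan S v -> lspan N (qrepr (qclass v) - v).
Proof.
move=> Sv; apply/qclassP => //; first exact: qrepr_lspan.
exact: qreprK.
Qed.

HB.instance Definition _ := gen_eqMixin subquot.
HB.instance Definition _ := gen_choiceMixin subquot.

Let add (C D : subquot) := qclass (qrepr C + qrepr D).
Let opp (C : subquot) := qclass (- qrepr C).
Let scale a (C : subquot) := qclass (a *: qrepr C).

Let addE u v : lspan S u -> lspan S v -> add (qclass u) (qclass v) = qclass (u + v).
Proof.
move=> Su Sv; apply/qclassP.
- by apply: lspanD; exact: qrepr_lspan.
- exact: lspanD.
- by rewrite opprD addrACA; apply: lspanD; exact: qrepr_qclass.
Qed.

Let oppE u : lspan S u -> opp (qclass u) = qclass (- u).
Proof.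
move=> Su; apply/qclassP; [by apply: lspanN; exact: qrepr_lspan | exact: lspanN |].
by rewrite -opprD; apply: lspanN; exact: qrepr_qclass.
Qed.

Let scaleE a u : lspan S u -> scale a (qclass u) = qclass (a *: u).
Proof.
move=> Su; apply/qclassP; [by apply: lspanZ; exact: qrepr_lspan | exact: lspanZ |].
by rewrite -scalerBr; apply: lspanZ; exact: qrepr_qclass.
Qed.

Let addA : associative add.
Proof.
move=> C D F; rewrite -(qreprK C) -(qreprK D) -(qreprK F).
have SC := qrepr_lspan C; have SD := qrepr_lspan D; have SF := qrepr_lspan F.
by rewrite !addE ?addrA //; exact: lspanD.
Qed.

Let addC : commutative add.
Proof. by move=> C D; rewrite /add addrC. Qed.

Let zero := qclass 0.

Let add0 : left_id zero add.
Proof.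
move=> C; rewrite -(qreprK C) addE ?add0r //; [exact: lspan0 | exact: qrepr_lspan].
Qed.

Let addN : left_inverse zero opp add.
Proof.
move=> C; rewrite -{1 2}(qreprK C); have SC := qrepr_lspan C.
by rewrite oppE // addE ?addNr //; exact: lspanN.
Qed.

HB.instance Definition _ := GRing.isZmodule.Build subquot addA addC add0 addN.

Let scaleA a b C : scale a (scale b C) = scale (a * b) C.
Proof.
rewrite -(qreprK C); have SC := qrepr_lspan C.
by rewrite !scaleE ?scalerA //; exact: lspanZ.
Qed.

Let scale1 : left_id 1 scale.
Proof.
by move=> C; rewrite -(qreprK C) scaleE ?scale1r //; exact: qrepr_lspan.
Qed.

Let scaleDr : right_distributive scale +%R.
Proof.
move=> a C D; rewrite /GRing.add /= -(qreprK C) -(qreprK D).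
have SC := qrepr_lspan C; have SD := qrepr_lspan D.
by rewrite addE // !scaleE ?addE ?scalerDr //; do ?[exact: lspanD|exact: lspanZ].
Qed.

Let scaleDl C : {morph scale^~ C : a b / a + b}.
Proof.
move=> a b; rewrite /GRing.add /= -(qreprK C); have SC := qrepr_lspan C.
by rewrite !scaleE ?addE ?scalerDl //; exact: lspanZ.
Qed.

HB.instance Definition _ := GRing.Zmodule_isLmodule.Build R subquot
  scaleA scale1 scaleDr scaleDl.

Lemma qclass_linear a u v : lspan S u -> lspan S v ->
  qclass (a *: u + v) = a *: qclass u + qclass v.
Proof.
move=> Su Sv; apply/esym; rewrite -(addE (lspanZ a Su) Sv).
by rewrite -(scaleE a Su).
Qed.

End Subquotient.

Section Calculus.
Context {R : realType} {n : nat}.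
Implicit Types (U : set 'rV[R]_n) (a : 'rV[R]_n) (f : 'rV[R]_n -> R).

Definition partial (i : 'I_n) f : 'rV[R]_n -> R := 'D_(delta_mx 0 i) f.

Fixpoint Ck (k : nat) U f : Prop :=
  if k is k'.+1 then
    (forall a, U a -> differentiable f a) /\ forall i, Ck k' U (partial i f)
  else forall a, U a -> {for a, continuous f}.

Definition smooth_at a f := exists2 U, open_nbhs a U & forall k, Ck k U f.

(* Multi-indices of length at most k. *)
Definition multi_index (k : nat) : finType :=
  {alpha : {ffun 'I_n -> 'I_k.+1} | (\sum_i alpha i <= k)%N}.

Definition dmulti k (alpha : multi_index k) f : 'rV[R]_n -> R :=
  foldr (fun i g => iter (val alpha i) (partial i) g) f (enum 'I_n).

End Calculus.

Section Manifold.
Context {R : realType} {n : nat}.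

Record chart (T : topologicalType) := Chart {
  cdom : set T;
  cmap : T -> 'rV[R]_n;
  cinv : 'rV[R]_n -> T }.

Definition is_chart (T : topologicalType) (c : chart T) :=
  [/\ open (cdom c), open (cmap c @` cdom c),
      forall x, cdom c x -> {for x, continuous (cmap c)},
      forall x, cdom c x -> cinv c (cmap c x) = x &
      forall a, (cmap c @` cdom c) a -> {for a, continuous (cinv c)}].

Definition compatible (T : topologicalType) (c c' : chart T) :=
  forall x, cdom c x -> cdom c' x ->
  forall i, smooth_at (cmap c x) (fun a => cmap c' (cinv c a) 0 i).

End Manifold.

Record manifold (R : realType) (n : nat) := Manifold {
  points :> topologicalType;
  atlas : set (@chart R n points);
  atlas_chart : forall c, atlas c -> is_chart c;
  atlas_cover : forall x, exists2 c, atlas c & cdom c x;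
  atlas_compatible : forall c c', atlas c -> atlas c' -> compatible c c';
  manifold_hausdorff : hausdorff_space points;
  manifold_second_countable : @second_countable points }.
Arguments atlas {R n} X : rename.

Section Bundle.
Context {R : realType} {n : nat} {X : manifold R n}.

Definition smooth_fun_at (x : X) (f : X -> R) :=
  forall c, atlas X c -> cdom c x -> smooth_at (cmap c x) (f \o cinv c).

(* A local trivialization, with R^m indexed by an arbitrary finite type.      *)
(* Outside of [tdom] the values of [tmap] are irrelevant.                     *)
Record trivialization (fib : X -> lmodType R) := Trivialization {
  tidx : finType;
  tdom : set X;
  tmap : forall x, fib x -> tidx -> R }.
Arguments tmap {fib} t {x} e i : rename.

Definition is_trivialization fib (t : trivialization fib) :=
  open (tdom t) /\ forall x, tdom t x ->
    (forall i, scalar (fun e : fib x => tmap t e i)) /\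
    bijective (fun e : fib x => tmap t e).

(* The data of a vector bundle; [vector_bundle] below states the axioms. *)
Record bundle := Bundle {
  fiber :> X -> lmodType R;
  trivs : trivialization fiber -> Prop }.
Arguments trivs : clear implicits.

(* [f] is given in local trivializations by matrices of smooth functions. *)
Definition smooth_in (fib fib' : X -> lmodType R)
    (t : trivialization fib) (t' : trivialization fib')
    (f : forall x, fib x -> fib' x) :=
  exists g : tidx t -> tidx t' -> X -> R,
  forall x, tdom t x -> tdom t' x ->
    (forall i j, smooth_fun_at x (g i j)) /\
    forall e j, tmap t' (f x e) j = \sum_i g i j x * tmap t e i.

Definition vector_bundle (E : bundle) :=
  [/\ forall t, trivs E t -> is_trivialization t,
      forall x, exists2 t, trivs E t & tdom t x &
      forall t t', trivs E t -> trivs E t' -> smooth_in t t' (fun x e => e)].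

Definition bundle_map (E F : bundle) (f : forall x, E x -> F x) :=
  (forall x, linear (f x)) /\
  forall t t', trivs E t -> trivs F t' -> smooth_in t t' f.

(* Set-theoretic sections; a local section is extended arbitrarily. *)
Definition section (E : bundle) : Type := forall x, E x.

Section SectionModule.
Variable E : bundle.
HB.instance Definition _ := gen_eqMixin (section E).
HB.instance Definition _ := gen_choiceMixin (section E).

Let add (s t : section E) : section E := fun x => s x + t x.
Let opp (s : section E) : section E := fun x => - s x.
Let zero : section E := fun x => 0.
Let scale a (s : section E) : section E := fun x => a *: s x.

Let addA : associative add.
Proof. by move=> s t u; apply/functional_extensionality_dep => x; exact: addrA. Qed.
Let addC : commutative add.
Proof. by move=> s t; apply/functional_extensionality_dep => x; exact: addrC. Qed.
Let add0 : left_id zero add.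
Proof. by move=> s; apply/functional_extensionality_dep => x; exact: add0r. Qed.
Let addN : left_inverse zero opp add.
Proof. by move=> s; apply/functional_extensionality_dep => x; exact: addNr. Qed.
HB.instance Definition _ :=
  GRing.isZmodule.Build (section E) addA addC add0 addN.

Let scaleA a b s : scale a (scale b s) = scale (a * b) s.
Proof. by apply/functional_extensionality_dep => x; exact: scalerA. Qed.
Let scale1 : left_id 1 scale.
Proof. by move=> s; apply/functional_extensionality_dep => x; exact: scale1r. Qed.
Let scaleDr : right_distributive scale +%R.
Proof. by move=> a s t; apply/functional_extensionality_dep => x; exact: scalerDr. Qed.
Let scaleDl s : {morph scale^~ s : a b / a + b}.
Proof. by move=> a b; apply/functional_extensionality_dep => x; exact: scalerDl. Qed.
HB.instance Definition _ := GRing.Zmodule_isLmodule.Build R (section E)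
  scaleA scale1 scaleDr scaleDl.
End SectionModule.

(* [s] is smooth on a neighborhood of [x]. *)
Definition smooth_section_at (E : bundle) (x : X) (s : section E) :=
  forall t, trivs E t -> tdom t x ->
  forall i, smooth_fun_at x (fun y => tmap t (s y) i).

(* W has local frames of smooth sections; its rank is locally constant. *)
Definition subbundle (E : bundle) (W : forall x, set (E x)) :=
  forall x, exists (I : finType) (e : I -> section E),
    (forall i, smooth_section_at x (e i)) /\
    \forall y \near x,
      W y = range (fun c : I -> R => \sum_i c i *: e i y) /\
      injective (fun c : I -> R => \sum_i c i *: e i y).

End Bundle.
Arguments bundle {R n} X.
Arguments tmap {R n X fib} t {x} e i : rename.
Arguments trivs {R n X} E t : rename.

Section Jets.
Context {R : realType} {n : nat} {X : manifold R n}.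
Implicit Types E F : bundle X.

Definition local_coord E (t : trivialization E) (c : chart X) (s : section E)
    (i : tidx t) : 'rV[R]_n -> R :=
  fun a => tmap t (s (cinv c a)) i.
#[global] Arguments local_coord {E} t c s i.

Definition vanishes k E (x : X) (s : section E) :=
  forall t c, trivs E t -> atlas X c -> tdom t x -> cdom c x ->
  forall i (alpha : multi_index k),
    dmulti alpha (local_coord t c s i) (cmap c x) = 0.

(* Sections smooth near x modulo those that vanish to order k at x; the chart *)
(* and trivialization used to test vanishing do not matter on vector bundles. *)
Definition jet_fiber k E (x : X) : lmodType R :=
  subquot [set s : section E | smooth_section_at x s]
          [set s : section E | smooth_section_at x s /\ vanishes k x s].

(* The usual jet coordinates: if u = j^k_x s, all the partial derivatives of  *)
(* order at most k, at x, of the local components of s.                       *)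
Definition jet_triv k E (t : trivialization E) (c : chart X) :
    trivialization (jet_fiber k E) :=
  @Trivialization R n X (jet_fiber k E) (multi_index (n := n) k * tidx t)%type
    (tdom t `&` cdom c)
    (fun x u ai => dmulti ai.1 (local_coord t c (qrepr u) ai.2) (cmap c x)).

Definition jet_bundle k E : bundle X :=
  @Bundle R n X (jet_fiber k E)
    (fun u => exists t c, [/\ trivs E t, atlas X c & u = jet_triv k t c]).

Definition jet k E (s : section E) : section (jet_bundle k E) :=
  fun x => qclass _ _ s.

(* The maps out of jet bundles below are computed on a representing section;  *)
(* for vector bundles the result does not depend on its choice.               *)

Definition jet_proj k l E x (u : jet_bundle k E x) : jet_bundle l E x :=
  jet l (qrepr u) x.

Definition jet_incl q r E x (u : jet_bundle (q + r) E x) :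
    jet_bundle r (jet_bundle q E) x :=
  jet r (jet q (qrepr u)) x.

Definition jet_map r E F (f : forall x, E x -> F x) x
    (u : jet_bundle r E x) : jet_bundle r F x :=
  jet r (fun y => f y (qrepr u y) : F y) x.

Definition prolong q r E F (Phi : forall x, jet_bundle q E x -> F x) x
    (u : jet_bundle (q + r) E x) : jet_bundle r F x :=
  jet_map Phi (jet_incl u).
#[global] Arguments prolong {q} r {E F} Phi x u.

Definition ker_map E F (f : forall x, E x -> F x) x : set (E x) :=
  [set e | f x e = 0].
#[global] Arguments ker_map {E F} f x.

Definition im_map E F (f : forall x, E x -> F x) x : set (F x) := range (f x).
#[global] Arguments im_map {E F} f x.

Definition coker_fiber E F (f : forall x, E x -> F x) (x : X) : lmodType R :=
  subquot [set: F x] (im_map f x).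

Definition coker_proj_fun E F (f : forall x, E x -> F x) x (v : F x) :
    coker_fiber f x :=
  qclass _ _ v.

(* The quotient bundle structure: a fiberwise linear isomorphism with R^m is  *)
(* a local trivialization when composing it with F -> coker f is smooth.      *)
Definition coker E F (f : forall x, E x -> F x) : bundle X :=
  @Bundle R n X (coker_fiber f)
    (fun t => is_trivialization t /\
              forall t', trivs F t' -> smooth_in t' t (@coker_proj_fun E F f)).

Definition coker_proj E F (f : forall x, E x -> F x) :
    forall x, F x -> coker f x :=
  @coker_proj_fun E F f.
#[global] Arguments coker_proj {E F} f x v.

(* 1-jets of the local sections of E with values in W *)
Definition jet1_sub E (W : forall x, set (E x)) x : set (jet_bundle 1 E x) :=
  [set jet 1 s x | s in [set s : section E |
     smooth_section_at x s /\ \forall y \near x, W y (s y)]].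

(* J_1(W) `&` J_(q+1)(E) in J_1(J_q(E)), seen in J_(q+1)(E) *)
Definition prolong_sub q E (W : forall x, set (jet_bundle q E x)) x :
    set (jet_bundle (q + 1) E x) :=
  [set u | jet1_sub W (jet_incl u)].
#[global] Arguments prolong_sub {q E} W x.

(* R_(q+r)^(s), the projection of R_(q+r+s) in J_(q+r)(E) *)
Definition proj_kernel q r s E F (Phi : forall x, jet_bundle q E x -> F x) x :
    set (jet_bundle (q + r) E x) :=
  [set jet_proj (q + r) u | u in ker_map (prolong (r + s) Phi) x].
#[global] Arguments proj_kernel {q} r s {E F} Phi x.

Definition regular q E F (Phi : forall x, jet_bundle q E x -> F x) :=
  forall r s, subbundle (ker_map (prolong r Phi)) /\
              subbundle (proj_kernel r s Phi).

End Jets.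

(* Main.v *)
(** For a vector bundle [E], two germs of sections have the same [k]-jet when
    all derivatives of order at most [k] of their difference vanish, so every
    map between jet bundles can be computed on sections: if [s] represents [w],
    then [rho_r(Phi) w] is the [r]-jet of [Phi (j_q s)].  Hence if [v] lies in
    [im rho_(r+1)(Phi)], then [rho_1(Psi_r) v] is the 1-jet of
    [Psi_r (rho_r(Phi) (j_(q+r) s)) = 0], which is the inclusion.

    For [ker rho_1(Psi_r) = rho_1(B_r)], regularity makes the rank of
    [rho_r(Phi)] locally constant, so that [Q_r] has local trivializations that
    lift to smooth sections of [J_r(F_0)].  Subtracting from a section whose
    image in [Q_r] vanishes to first order the lift of that image changes its
    1-jet by nothing and moves the section into [B_r].

    The inclusion is strict for [Phi] the identity of [J_1(E)], with [E] the
    trivial line bundle over the real line: [Q_0 = 0], so that the right-hand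
    side is all of [J_1(J_1(E))], while [B_1] is the image of [J_2(E)]. *)

Require Import Defs.
From HB Require Import structures.
From mathcomp Require Import all_boot all_order all_algebra.
From mathcomp Require Import all_classical all_reals all_analysis.
Import Order.TTheory GRing.Theory Num.Theory.
Import numFieldNormedType.Exports.
Local Open Scope classical_set_scope.

Set Implicit Arguments.
Unset Strict Implicit.
Unset Printing Implicit Defensive.
Local Open Scope ring_scope.

(** * Smooth functions on R^n *)

(** Sections are total functions that are meaningful only near a point, and an equality at a single
    point does not survive differentiation; hence functions, jets and cokernel classes are compared
    on neighborhoods throughout. Jet coordinates fix an order of differentiation, whereas the
    inclusion of [J_(q+r)(E)] in [J_r(J_q(E))] concatenates derivatives. This is where the symmetry
    of mixed partial derivatives is needed, and why flatness is phrased with words of indices. The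
    transformation law of higher derivatives is avoided twice: the order of vanishing passes between
    charts by induction, with the first-order chain rule only, and the transition functions of a jet
    bundle are obtained by inverting the coordinate matrix of a frame made of jets of Taylor
    monomials. The cokernel is not known from the start to be covered by trivializations: these have
    to be built from the constancy of the rank. Facts about maps into it therefore rest on the
    linearity of the trivializations of the target. *)

Lemma differentiable_near_eq {R : numFieldType} {V W : normedModType R}
    (f g : V -> W) (a : V) :
  (\near a, f a = g a) -> differentiable f a -> differentiable g a.
Proof.
move=> fg df; have fga := nbhs_singleton fg.
(* Near [a] both functions have the same first-order expansion, with linear part ['d f a];
   uniqueness of the differential identifies this part with ['d g a]. *)
have E : g \o shift a = cst (g a) + 'd f a +o_ 0 id.
  move/diff_locally : df => /eqaddoP Ef; apply/eqaddoP => e e0.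
  rewrite (near_shift 0 a) in fg.
  near=> z.
  have -> : (g \o shift a - (cst (g a) + 'd f a)) z = (f \o shift a - (cst (f a) + 'd f a)) z.
    have : ((fun a : V => f a = g a) \o shift (a - 0)) z by near: z.
    by rewrite /= subr0 !fctE /= fga => ->.
  by near: z; exact: Ef.
have := diff_unique (diff_continuous df) E => dE.
by apply/diff_locallyP; rewrite dE; split => //; exact: diff_continuous.
Unshelve. all: by end_near. Qed.

Section SmoothFunctions.
Context {R : realType} {n : nat}.
Notation V := 'rV[R]_n.
Implicit Types (U W : set V) (a b v : V) (f g : V -> R) (phi : V -> V).
Implicit Types (i j : 'I_n) (k l : nat).

Lemma partial_near_eq i f g a :
  (\near a, f a = g a) -> \near a, partial i f a = partial i g a.
Proof. by move=> /near_join; apply: filterS => b; exact: near_eq_derive. Qed.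

Lemma open_near U (P : V -> Prop) a :
  open U -> (forall b, U b -> P b) -> U a -> \forall b \near a, P b.
Proof. by move=> oU UP Ua; apply: filterS UP _; exact: open_nbhs_nbhs. Qed.

(** Openness of [U] turns agreement on [U] into agreement near each of its points, which passes to
    the partial derivatives. *)
Lemma Ck_ext k U f g : open U -> (forall b, U b -> f b = g b) -> Ck k U f -> Ck k U g.
Proof.
move=> oU; elim: k f g => [|k IH] f g fg /=.
  move=> cf a Ua; have := cf a Ua; rewrite /prop_for /continuous_at -(fg a Ua).
  apply: cvg_trans; apply: (@near_eq_cvg _ _ (nbhs a)).
  by apply: (open_near (U:=U)) => // b Ub; rewrite fg.
move=> [df cf]; split=> [a Ua|i].
  by apply: differentiable_near_eq (df a Ua); apply: (open_near (U:=U)).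
apply: IH (cf i) => b Ub; apply: near_eq_derive.
exact: (open_near (U:=U)).
Qed.

Lemma Ck_pred k U f : Ck k.+1 U f -> Ck k U f.
Proof.
elim: k f => [|k IH] f [df cf].
  by move=> a Ua; exact: differentiable_continuous (df a Ua).
by split=> // i; apply: IH; exact: cf.
Qed.

Lemma Ck_sub k U W f : U `<=` W -> Ck k W f -> Ck k U f.
Proof.
move=> UW; elim: k f => [|k IH] f /=; first by move=> cf a /UW; exact: cf.
by move=> [df cf]; split=> [a /UW|i]; [exact: df|apply: IH].
Qed.

Lemma Ck_cst k U (r : R) : open U -> Ck k U (fun=> r).
Proof.
move=> oU; elim: k r => [|k IH] r; first by move=> a _; exact: cst_continuous.
split=> [a _|i]; first exact: differentiable_cst.
by apply: Ck_ext (IH 0) => // b _; rewrite /partial derive_cst.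
Qed.

Lemma CkD k U f g : open U -> Ck k U f -> Ck k U g -> Ck k U (fun a => f a + g a).
Proof.
move=> oU; elim: k f g => [|k IH] f g.
  by move=> cf cg a Ua; exact: continuousD (cf a Ua) (cg a Ua).
move=> [df cf] [dg cg]; split=> [a Ua|i]; first exact: differentiableD (df a Ua) (dg a Ua).
apply: Ck_ext (IH _ _ (cf i) (cg i)) => // b Ub; rewrite /partial -deriveD //.
- exact/diff_derivable/df.
- exact/diff_derivable/dg.
Qed.

Lemma CkM k U f g : open U -> Ck k U f -> Ck k U g -> Ck k U (fun a => f a * g a).
Proof.
move=> oU; elim: k f g => [|k IH] f g.
  by move=> cf cg a Ua; exact: continuousM (cf a Ua) (cg a Ua).
move=> Cf Cg; have [df cf] := Cf; have [dg cg] := Cg.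
split=> [a Ua|i]; first exact: differentiableM (df a Ua) (dg a Ua).
have := CkD oU (IH _ _ (Ck_pred Cf) (cg i)) (IH _ _ (Ck_pred Cg) (cf i)).
apply: Ck_ext => // b Ub; rewrite /partial.
by rewrite [RHS](@deriveM R V f g) //; [exact/diff_derivable/df|exact/diff_derivable/dg].
Qed.

Lemma CkV k U f : open U -> (forall a, U a -> f a != 0) ->
  Ck k U f -> Ck k U (fun a => (f a)^-1).
Proof.
move=> oU f0; elim: k => [|k IH].
  by move=> cf a Ua; exact: continuousV (f0 a Ua) (cf a Ua).
move=> Cf; have [df cf] := Cf; have Cfp := IH (Ck_pred Cf).
split=> [a Ua|i]; first exact: differentiableV (df a Ua) (f0 a Ua).
have := CkM oU (CkM oU Cfp Cfp) (CkM oU (Ck_cst k (-1) oU) (cf i)).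
apply: Ck_ext => // b Ub; rewrite /partial [RHS]deriveV ?f0//; last exact/diff_derivable/df.
by rewrite mulN1r mulrN -mulNr -invfM -expr2.
Qed.

Lemma Ck_sum (I : Type) (r : seq I) (P : pred I) k U (F : I -> V -> R) : open U ->
  (forall x, Ck k U (F x)) -> Ck k U (fun a => \sum_(x <- r | P x) F x a).
Proof.
move=> oU CF; elim: r => [|x r IH].
  by apply: Ck_ext (Ck_cst k 0 oU) => // b _; rewrite big_nil.
case: (boolP (P x)) => Px.
  by apply: Ck_ext (CkD oU (CF x) IH) => // b _; rewrite big_cons Px.
by apply: Ck_ext IH => // b _; rewrite big_cons (negbTE Px).
Qed.

Lemma coord_decomp phi :
  phi = \sum_(j < n) (fun a => phi a 0 j *: (delta_mx 0 j : V)).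
Proof.
apply/funext => a; rewrite fct_sumE [LHS]matrix_sum_delta (big_ord_recl 0) big_ord0.
by rewrite addr0; apply: eq_bigr => j _.
Qed.

Lemma differentiable_rV phi a :
  (forall j, differentiable (fun b => phi b 0 j) a) -> differentiable phi a.
Proof.
move=> dphi; rewrite (coord_decomp phi).
by apply: differentiable_sum => j; exact: differentiableZl.
Qed.

Lemma diff_rV phi a v i :
  (forall j, differentiable (fun b => phi b 0 j) a) ->
  ('d phi a v) 0 i = 'd (fun b => phi b 0 i) a v.
Proof.
move=> dphi; have dp := differentiable_rV dphi.
rewrite -!deriveE // derive_mx ?mxE //; exact: diff_derivable.
Qed.

Lemma derive_comp_rV phi f a v :
  (forall j, differentiable (fun b => phi b 0 j) a) -> differentiable f (phi a) ->
  'D_v (f \o phi) a = \sum_j 'D_(delta_mx 0 j) f (phi a) * 'D_v (fun b => phi b 0 j) a.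
Proof.
move=> dphi df; have dp := differentiable_rV dphi.
rewrite deriveE; last exact: differentiable_comp.
rewrite diff_comp //= [X in 'd f _ X]matrix_sum_delta (big_ord_recl 0) big_ord0 addr0.
rewrite linear_sum /=; apply: eq_bigr => j _.
by rewrite linearZ /= diff_rV // !deriveE // mulrC.
Qed.

Lemma continuous_rV phi a :
  (forall j, {for a, continuous (fun b => phi b 0 j)}) -> {for a, continuous phi}.
Proof.
move=> cphi; apply/(@cvgrPdist_le R V V (nbhs a)) => /= e e0; near=> b.
rewrite /Num.Def.normr/= mx_normrE (bigmax_le _ (ltW e0))//= => -[i j] _.
rewrite !mxE/= !ord1; move: j; near: b; apply: filter_forall => /= j.
exact: ((cvgrPdist_le _ _).1 (cphi j)).
Unshelve. all: by end_near. Qed.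

(** By the chain rule a partial derivative of the composite is a sum of products of
    [partial j f \o phi], handled by induction on [k], and partial derivatives of the components of
    [phi]. *)
Lemma Ck_comp k U W phi f : open U -> open W -> (forall a, U a -> W (phi a)) ->
  (forall j, Ck k U (fun a => phi a 0 j)) -> Ck k W f -> Ck k U (f \o phi).
Proof.
move=> oU oW UW; elim: k f => [|k IH] f.
  move=> cphi cf a Ua; apply: continuous_comp; last exact/cf/UW.
  by apply: continuous_rV => j; exact: cphi.
move=> Cphi Cf; have [df cf] := Cf.
have dphi a j : U a -> differentiable (fun b => phi b 0 j) a.
  by move=> Ua; have [dp _] := Cphi j; exact: dp.
split=> [a Ua|i].
  apply: differentiable_comp; last exact/df/UW.
  by apply: differentiable_rV => j; exact: dphi.
have Cp j : Ck k U (fun a => phi a 0 j) by exact: Ck_pred.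
have := @Ck_sum _ (index_enum 'I_n) xpredT k U
  (fun j a => partial j f (phi a) * partial i (fun b => phi b 0 j) a) oU.
move=> /(_ (fun j => CkM oU (IH _ Cp (cf j)) ((Cphi j).2 i))).
apply: Ck_ext => // b Ub; rewrite /partial derive_comp_rV //; last exact/df/UW.
by move=> j; exact: dphi.
Qed.

Lemma Ck_coord k U j : open U -> Ck k U (fun a => a 0 j).
Proof.
move=> oU; case: k => [|k]; first by move=> a _; exact: coord_continuous.
split=> [a _|i]; first exact: differentiable_coord.
apply: Ck_ext (Ck_cst k (i == j)%:R oU) => // b _; rewrite /partial.
have := @derive_mx R V 1 n id b _ (@derivable_id R V b (delta_mx 0 i)).
rewrite derive_id => /matrixP /(_ 0 j); rewrite !mxE eqxx /= => <-.
by rewrite eq_sym.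
Qed.

End SmoothFunctions.

(** * Germs of smooth functions and their order of vanishing *)

Lemma near_forall (I : finType) (T : topologicalType) (a : T) (P : I -> T -> Prop) :
  (forall i, \forall b \near a, P i b) -> \forall b \near a, forall i, P i b.
Proof. exact: (@filter_forall T I P (nbhs a) _). Qed.

Lemma near_open (T : topologicalType) (a : T) (P : T -> Prop) :
  (\forall b \near a, P b) -> exists2 U, open_nbhs a U & U `<=` P.
Proof. by move=> H; have : nbhs a P by []; rewrite nbhsE. Qed.

Section SmoothGerms.
Context {R : realType} {n : nat}.
Notation V := 'rV[R]_n.
Implicit Types (U W : set V) (a b v : V) (f g : V -> R) (phi : V -> V).
Implicit Types (i j : 'I_n) (k l : nat) (w : seq 'I_n).

Lemma smooth_at_eq f g a : (\near a, f a = g a) -> smooth_at a f -> smooth_at a g.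
Proof.
move=> /near_open[W [oW Wa] fg] [U [oU Ua] CU].
exists (U `&` W) => [|k]; first by split; [exact: openI|].
apply: (Ck_ext (openI oU oW) (f := f)); first by move=> b [_ /fg].
by apply: Ck_sub (CU k) => b [].
Qed.

Lemma smooth_at_near f a : smooth_at a f -> \forall b \near a, smooth_at b f.
Proof.
move=> [U [oU Ua] CU]; apply: (open_near oU) Ua => b Ub.
by exists U.
Qed.

Lemma smooth_at_cst a (r : R) : smooth_at a (fun=> r).
Proof. by exists setT => [|k]; [split => //; exact: openT|apply: Ck_cst; exact: openT]. Qed.

Lemma smooth_at2 (op : (V -> R) -> (V -> R) -> (V -> R)) :
  (forall k U f g, open U -> Ck k U f -> Ck k U g -> Ck k U (op f g)) ->
  forall f g a, smooth_at a f -> smooth_at a g -> smooth_at a (op f g).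
Proof.
move=> Cop f g a [U [oU Ua] CU] [W [oW Wa] CW].
exists (U `&` W) => [|k]; first by split; [exact: openI|].
by apply: Cop; [exact: openI|apply: Ck_sub (CU k)|apply: Ck_sub (CW k)] => b [].
Qed.

Lemma smooth_atD f g a : smooth_at a f -> smooth_at a g -> smooth_at a (fun b => f b + g b).
Proof. by apply: (smooth_at2 (op := fun f g b => f b + g b)) => k U f' g' oU; exact: CkD. Qed.

Lemma smooth_atM f g a : smooth_at a f -> smooth_at a g -> smooth_at a (fun b => f b * g b).
Proof. by apply: (smooth_at2 (op := fun f g b => f b * g b)) => k U f' g' oU; exact: CkM. Qed.

Lemma smooth_at_cont f a : smooth_at a f -> {for a, continuous f}.
Proof. by move=> [U [oU Ua] CU]; have := CU 0; apply. Qed.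

Lemma smooth_at_diff f a : smooth_at a f -> differentiable f a.
Proof. by move=> [U [oU Ua] CU]; have [] := CU 1 => dU _; exact: dU. Qed.

Lemma smooth_at_derivable f a v : smooth_at a f -> derivable f a v.
Proof. by move=> /smooth_at_diff; exact: diff_derivable. Qed.

Lemma smooth_atV f a : f a != 0 -> smooth_at a f -> smooth_at a (fun b => (f b)^-1).
Proof.
move=> fa0 sf; have [U [oU Ua] CU] := sf.
have : \forall b \near a, f b != 0.
  exact: (@cvgr_neq0 R R V (nbhs a) _ f (f a) (smooth_at_cont sf) fa0).
move=> /near_open[W [oW Wa] W0].
exists (U `&` W) => [|k]; first by split; [exact: openI|].
by apply: CkV; [exact: openI|move=> b [_ /W0]|apply: Ck_sub (CU k) => b []].
Qed.

Lemma smooth_at_big (I : Type) (r : seq I) (P : pred I) (F : I -> V -> R) op x0 a :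
  (forall f g, smooth_at a f -> smooth_at a g -> smooth_at a (fun b => op (f b) (g b))) ->
  (forall x, P x -> smooth_at a (F x)) ->
  smooth_at a (fun b => \big[op/x0]_(x <- r | P x) F x b).
Proof.
move=> sop sF; elim: r => [|x r IH].
  by apply: smooth_at_eq (smooth_at_cst a x0); near=> b; rewrite big_nil.
have [Px|Px] := boolP (P x).
  by apply: smooth_at_eq (sop _ _ (sF x Px) IH); near=> b; rewrite big_cons Px.
by apply: smooth_at_eq IH; near=> b; rewrite big_cons (negbTE Px).
Unshelve. all: by end_near. Qed.

Lemma smooth_at_sum (I : Type) (r : seq I) (P : pred I) (F : I -> V -> R) a :
  (forall x, P x -> smooth_at a (F x)) -> smooth_at a (fun b => \sum_(x <- r | P x) F x b).
Proof. by apply: smooth_at_big => f g; exact: smooth_atD. Qed.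

Lemma smooth_at_prod (I : Type) (r : seq I) (P : pred I) (F : I -> V -> R) a :
  (forall x, P x -> smooth_at a (F x)) -> smooth_at a (fun b => \prod_(x <- r | P x) F x b).
Proof. by apply: smooth_at_big => f g; exact: smooth_atM. Qed.

Lemma smooth_at_coord j a : smooth_at a (fun b => b 0 j).
Proof. by exists setT => [|k]; [split => //; exact: openT|apply: Ck_coord; exact: openT]. Qed.

Lemma smooth_at_partial i f a : smooth_at a f -> smooth_at a (partial i f).
Proof. by move=> [U oU CU]; exists U => // k; have [_] := CU k.+1; apply. Qed.

Lemma near_continuous phi a (P : V -> Prop) :
  {for a, continuous phi} -> (\forall b \near phi a, P b) -> \forall b \near a, P (phi b).
Proof. by move=> cphi Pa; exact: cphi. Qed.

Lemma smooth_at_comp phi f a : (forall j, smooth_at a (fun b => phi b 0 j)) ->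
  smooth_at (phi a) f -> smooth_at a (f \o phi).
Proof.
move=> sphi [W [oW Wa] CW].
have cphi : {for a, continuous phi}.
  by apply: continuous_rV => j; exact: smooth_at_cont.
have H : \forall b \near a, W (phi b) by apply: near_continuous cphi _; exact: open_nbhs_nbhs.
have /choice[Us HU] : forall j, exists U : set V, open_nbhs a U /\ forall k, Ck k U (fun b => phi b 0 j).
  by move=> j; have [U oU CU] := sphi j; exists U.
have : \forall b \near a, W (phi b) /\ forall j, Us j b.
  have HUs : \forall b \near a, forall j, Us j b.
    by apply: near_forall => j; have [oU _] := HU j; exact: open_nbhs_nbhs.
  by apply: filterS2 H HUs.
move=> /near_open[U [oU Ua] UW]; exists U => // k.
apply: (Ck_comp oU oW) (CW k); first by move=> b /UW[].
by move=> j; have [_ CU] := HU j; apply: Ck_sub (CU k) => b /UW[_]; exact.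
Unshelve. all: by end_near. Qed.

Lemma partialD i f g a : smooth_at a f -> smooth_at a g ->
  partial i (fun b => f b + g b) a = partial i f a + partial i g a.
Proof. by move=> sf sg; rewrite /partial -deriveD //; exact: smooth_at_derivable. Qed.

Lemma partialM i f g a : smooth_at a f -> smooth_at a g ->
  partial i (fun b => f b * g b) a = f a * partial i g a + g a * partial i f a.
Proof. by move=> sf sg; rewrite /partial [LHS](@deriveM R V f g) //; exact: smooth_at_derivable. Qed.

Lemma partial_cst i (r : R) a : partial i (fun=> r) a = 0.
Proof. exact: derive_cst. Qed.

Lemma partial_coord i j a : partial i (fun b => b 0 j) a = (i == j)%:R.
Proof.
rewrite /partial; have := @derive_mx R V 1 n id a _ (@derivable_id R V a (delta_mx 0 i)).
rewrite derive_id => /matrixP /(_ 0 j); rewrite !mxE eqxx /= => <-.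
by rewrite eq_sym.
Qed.

Lemma partial_comp i phi f a : (forall j, smooth_at a (fun b => phi b 0 j)) ->
  smooth_at (phi a) f ->
  partial i (f \o phi) a = \sum_j partial j f (phi a) * partial i (fun b => phi b 0 j) a.
Proof.
move=> sphi sf; rewrite /partial derive_comp_rV //; last exact: smooth_at_diff.
by move=> j; exact: smooth_at_diff.
Qed.

Definition dword w f := foldr (@partial R n) f w.

Lemma dword_near_eq w f g a :
  (\near a, f a = g a) -> \near a, dword w f a = dword w g a.
Proof. by move=> fg; elim: w => //= i w IH; exact: partial_near_eq. Qed.

Lemma smooth_at_dword w f a : smooth_at a f -> smooth_at a (dword w f).
Proof. by move=> sf; elim: w => //= i w IH; exact: smooth_at_partial. Qed.

Lemma dword_cat w w' f : dword (w ++ w') f = dword w (dword w' f).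
Proof. exact: foldr_cat. Qed.

Lemma near_smooth2 f g a (P : V -> Prop) : smooth_at a f -> smooth_at a g ->
  (forall b, smooth_at b f -> smooth_at b g -> P b) -> \forall b \near a, P b.
Proof.
move=> /smooth_at_near sf /smooth_at_near sg H; near=> b; apply: H; near: b => //.
Unshelve. all: by end_near. Qed.

Lemma dwordD w f g a : smooth_at a f -> smooth_at a g ->
  \forall b \near a, dword w (fun b => f b + g b) b = dword w f b + dword w g b.
Proof.
move=> sf sg; elim: w => [|i w IH] /=; first by near=> b.
have H := partial_near_eq i IH.
have : \forall b \near a, partial i (fun b => dword w f b + dword w g b) b =
   partial i (dword w f) b + partial i (dword w g) b.
  apply: near_smooth2 (smooth_at_dword w sf) (smooth_at_dword w sg) _ => b.
  exact: partialD.
by apply: filterS2 H => b -> ->.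
Unshelve. all: by end_near. Qed.

Lemma dwordZ w f (r : R) a : smooth_at a f ->
  \forall b \near a, dword w (fun b => r * f b) b = r * dword w f b.
Proof.
move=> sf; elim: w => [|i w IH] /=; first by near=> b.
have H := partial_near_eq i IH.
have : \forall b \near a, partial i (fun b => r * dword w f b) b = r * partial i (dword w f) b.
  apply: filterS (smooth_at_near (smooth_at_dword w sf)) => b sb.
  by rewrite partialM // ?partial_cst ?mulr0 ?addr0 //; exact: smooth_at_cst.
by apply: filterS2 H => b -> ->.
Unshelve. all: by end_near. Qed.

(* [dword] spells out the order of differentiation, unlike [dmulti]: this makes
   composition of derivatives a concatenation, and [flat_atP] shows that the
   two ways of testing flatness agree. *)
Definition flat_at k a f := forall w, (size w <= k)%N -> dword w f a = 0.

Lemma flat_at0 a f : flat_at 0 a f <-> f a = 0.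
Proof. by split=> [/(_ [::])|fa [|//]] //; apply. Qed.

Lemma flat_atS k a f :
  flat_at k.+1 a f <-> f a = 0 /\ forall i, flat_at k a (partial i f).
Proof.
split=> [ff|[f0 ff] w].
  split=> [|i w sw]; first exact: (ff [::]).
  by have := ff (rcons w i); rewrite size_rcons /dword foldr_rcons; apply.
case/lastP: w => // w i; rewrite size_rcons ltnS => sw.
by rewrite /dword foldr_rcons; exact: ff.
Qed.

Lemma flat_at_le k l a f : (l <= k)%N -> flat_at k a f -> flat_at l a f.
Proof. by move=> lk ff w sw; apply: ff; exact: leq_trans lk. Qed.

Lemma flat_at_eq k a f g : (\near a, f a = g a) -> flat_at k a f -> flat_at k a g.
Proof. by move=> fg ff w sw; rewrite -(nbhs_singleton (dword_near_eq w fg)) ff. Qed.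

Lemma flat_atD k a f g : smooth_at a f -> smooth_at a g ->
  flat_at k a f -> flat_at k a g -> flat_at k a (fun b => f b + g b).
Proof.
move=> sf sg ff fg w sw.
by rewrite (nbhs_singleton (dwordD w sf sg)) ff ?fg ?addr0.
Qed.

(** In both terms of the product rule one factor, [f] or [partial i f], is still flat to order [k].
    The induction generalizes over [g], which gets differentiated as well. *)
Lemma flat_atM k a f g : smooth_at a f -> smooth_at a g ->
  flat_at k a f -> flat_at k a (fun b => f b * g b).
Proof.
elim: k f g => [|k IH] f g sf sg; first by rewrite !flat_at0 => ->; rewrite mul0r.
move=> ff; have /flat_atS[f0 dff] := ff; apply/flat_atS; split=> [|i]; first by rewrite f0 mul0r.
have E : \forall b \near a, f b * partial i g b + partial i f b * g b =
    partial i (fun b => f b * g b) b.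
  by apply: near_smooth2 sf sg _ => b sf sg; rewrite partialM // [_ * g b]mulrC.
apply: (flat_at_eq E); apply: flat_atD.
- by apply: smooth_atM => //; exact: smooth_at_partial.
- by apply: smooth_atM => //; exact: smooth_at_partial.
- by apply: IH => //; [exact: smooth_at_partial|exact: flat_at_le ff].
- by apply: IH => //; exact: smooth_at_partial.
Qed.

Lemma flat_at_zero k a : flat_at k a (fun=> 0).
Proof.
elim: k => [|k IH]; first by rewrite flat_at0.
apply/flat_atS; split=> // i.
by apply: flat_at_eq IH; near=> b; rewrite partial_cst.
Unshelve. all: by end_near. Qed.

Lemma flat_at_sum (I : Type) (r : seq I) (P : pred I) (F : I -> V -> R) k a :
  (forall x, P x -> smooth_at a (F x)) -> (forall x, P x -> flat_at k a (F x)) ->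
  flat_at k a (fun b => \sum_(x <- r | P x) F x b).
Proof.
move=> sF fF; elim: r => [|x r IH].
  by apply: flat_at_eq (@flat_at_zero k a); near=> b; rewrite big_nil.
have [Px|Px] := boolP (P x).
  have := flat_atD (sF x Px) (smooth_at_sum r sF) (fF x Px) IH.
  by apply: flat_at_eq; near=> b; rewrite big_cons Px.
by apply: flat_at_eq IH; near=> b; rewrite big_cons (negbTE Px).
Unshelve. all: by end_near. Qed.

(** The chain rule writes a first derivative of the composite as a combination of the
    [partial j f \o phi], which are flat to one order less by induction. Applied to transition maps,
    this makes the order of vanishing independent of the chart. *)
Lemma flat_at_comp k phi f a : (forall j, smooth_at a (fun b => phi b 0 j)) ->
  smooth_at (phi a) f -> flat_at k (phi a) f -> flat_at k a (f \o phi).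
Proof.
move=> sphi; elim: k f => [|k IH] f sf; first by rewrite !flat_at0.
have cphi : {for a, continuous phi}.
  by apply: continuous_rV => j; exact: smooth_at_cont.
move=> /flat_atS[f0 dff]; apply/flat_atS; split=> // i.
have E : \forall b \near a,
    \sum_j partial j f (phi b) * partial i (fun b => phi b 0 j) b = partial i (f \o phi) b.
  have sf' := near_continuous cphi (smooth_at_near sf).
  have sphi' : \forall b \near a, forall j, smooth_at b (fun b => phi b 0 j).
    by apply: near_forall => j; exact: smooth_at_near.
  by apply: filterS2 sf' sphi' => b sfb sphib; rewrite partial_comp.
have sp j : smooth_at a (partial j f \o phi).
  by apply: smooth_at_comp => //; exact: smooth_at_partial.
apply: (flat_at_eq E); apply: flat_at_sum => j _.
  by apply: smooth_atM (sp j) _; exact: smooth_at_partial.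
apply: flat_atM; [exact: sp|exact: smooth_at_partial|].
by apply: IH; [exact: smooth_at_partial|exact: dff].
Qed.

End SmoothGerms.

(** * Symmetry of mixed partial derivatives *)

Section Schwarz.
Context {R : realType} {n : nat}.
Notation V := 'rV[R]_n.
Implicit Types (a b u v : V) (f g : V -> R) (phi : V -> V).
Implicit Types (i j : 'I_n) (k l : nat) (w : seq 'I_n).

Lemma is_derive_line f b v (s : R) : derivable f (b + s *: v) v ->
  is_derive s 1 (fun t => f (b + t *: v)) ('D_v f (b + s *: v)).
Proof.
move=> df.
have E : (fun h : R => h^-1 *: (((fun t => f (b + t *: v)) \o shift s) (h *: 1) - f (b + s *: v)))
    = (fun h => h^-1 *: ((f \o shift (b + s *: v)) (h *: v) - f (b + s *: v))).
  apply/boolp.funext => h /=; congr (_ *: (f _ - _)).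
  by rewrite scalerDl [h *: 1]mulr1 addrCA.
apply: DeriveDef; first by rewrite /derivable E.
by rewrite /derive E.
Qed.

Lemma growth_rate_translate f b v u :
  (fun h : R => h^-1 *: (((fun x => f (x + u)) \o shift b) (h *: v) - f (b + u))) =
  (fun h => h^-1 *: ((f \o shift (b + u)) (h *: v) - f (b + u))).
Proof. by apply/boolp.funext => h /=; rewrite addrA. Qed.

Lemma mean_value_line f b v (h : R) : 0 < h ->
  (forall s, 0 <= s <= h -> derivable f (b + s *: v) v) ->
  exists2 s, 0 < s < h & f (b + h *: v) - f b = h * 'D_v f (b + s *: v).
Proof.
move=> h0 df.
have [||s] := @MVT R (fun t => f (b + t *: v)) (fun t => 'D_v f (b + t *: v)) 0 h h0.
- move=> s; rewrite in_itv /= => /andP[s0 sh]; apply: is_derive_line; apply: df.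
  by rewrite !ltW.
- apply: derivable_within_continuous => s; rewrite in_itv /= => sh.
  by have [] := is_derive_line (df s sh).
rewrite in_itv /= => sh; rewrite scale0r addr0 subr0 mulrC => E.
by exists s.
Qed.

Lemma near_plane a u v (P : V -> Prop) : (\forall b \near a, P b) ->
  exists2 e : R, 0 < e & forall s t, 0 <= s <= e -> 0 <= t <= e -> P (a + s *: u + t *: v).
Proof.
move=> /nbhs_ballP[r /= r0 aP].
have c0 : 0 < `|u| + `|v| + 1 by rewrite ltr_wpDl ?addr_ge0.
(* With this bound [s *: u + t *: v] has norm at most [r / 2]. The summand 1 keeps the denominator
   positive when [u] and [v] vanish. *)
exists (r / 2 / (`|u| + `|v| + 1)); first by rewrite !divr_gt0.
move=> s t /andP[s0 se] /andP[t0 te]; apply: aP.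
rewrite -ball_normE /= -addrA opprD addNKr normrN.
apply: le_lt_trans (ler_normD _ _) _; rewrite !normrZ !ger0_norm //.
apply: (@le_lt_trans _ _ (r / 2 / (`|u| + `|v| + 1) * (`|u| + `|v| + 1))).
  rewrite 2!mulrDr mulr1 -[leLHS]addr0 !lerD ?ler_wpM2r //.
  by rewrite !divr_ge0 ?ltW.
by rewrite divfK ?gt_eqF // ltr_pdivrMr // mulr2n mulrDr mulr1 ltrDl.
Qed.

(* The mean value theorem, applied once in each of the two directions. *)
Lemma double_difference f a (i j : 'I_n) (P : V -> Prop) : smooth_at a f ->
  (\forall b \near a, P b) ->
  exists2 e : R, 0 < e & forall h, 0 < h -> h <= e ->
    exists2 p, P p & f (a + h *: delta_mx 0 i + h *: delta_mx 0 j)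
       - f (a + h *: delta_mx 0 i) - f (a + h *: delta_mx 0 j) + f a
     = h ^+ 2 * partial j (partial i f) p.
Proof.
set u : V := delta_mx 0 i; set v : V := delta_mx 0 j.
move=> sf Pa.
have [e e0 He] : exists2 e : R, 0 < e & forall s t, 0 <= s <= e -> 0 <= t <= e ->
    smooth_at (a + s *: u + t *: v) f /\ P (a + s *: u + t *: v).
  apply: (@near_plane a u v (fun b => smooth_at b f /\ P b)).
  by apply: filterS2 (smooth_at_near sf) Pa.
exists e => // h h0 he.
(* The second difference of [f] is the increment of [g] along [u], and the derivative of [g] along
   [u] is an increment of [partial i f] along [v]. *)
pose g b := f (b + h *: v) - f b.
have sf0 s t : 0 <= s <= h -> 0 <= t <= h -> smooth_at (a + s *: u + t *: v) f.
  move=> /andP[s0 sh] /andP[t0 th].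
  by have [] := He s t; rewrite ?s0 ?t0 ?(le_trans sh) ?(le_trans th).
have h01 : 0 <= h <= h by rewrite lexx ltW.
have z01 : 0 <= (0 : R) <= h by rewrite lexx ltW.
have dsh s : 0 <= s <= h -> derivable (fun b => f (b + h *: v)) (a + s *: u) u.
  move=> sh; rewrite /derivable growth_rate_translate.
  by apply: smooth_at_derivable; exact: sf0.
have df1 s : 0 <= s <= h -> derivable f (a + s *: u) u.
  move=> sh; apply: smooth_at_derivable.
  by have := sf0 s 0 sh z01; rewrite scale0r addr0.
have [|s sh Es] := @mean_value_line g a u h h0.
  by move=> s sh; apply: derivableB (dsh s sh) (df1 s sh).
have sh' : 0 <= s <= h by case/andP: sh => *; rewrite !ltW.
have Eg : 'D_u g (a + s *: u) = partial i f (a + s *: u + h *: v) - partial i f (a + s *: u).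
  rewrite deriveB; [|exact: dsh|exact: df1].
  by rewrite {1}/derive growth_rate_translate.
have [|t th Et] := @mean_value_line (partial i f) (a + s *: u) v h h0.
  by move=> t th; apply: smooth_at_derivable; apply: smooth_at_partial; exact: sf0.
have th' : 0 <= t <= h by case/andP: th => *; rewrite !ltW.
exists (a + s *: u + t *: v).
  case/andP: sh' th' => s0 sh' /andP[t0 th'].
  by have [] := He s t; rewrite ?s0 ?t0 ?(le_trans sh') ?(le_trans th').
rewrite expr2 -mulrA -[partial j _ _]/('D_v (partial i f) _) -Et -Eg -Es /g.
by rewrite opprB addrA addrAC -!addrA; congr (_ + _); rewrite addrCA addrC -addrA.
Qed.

(** The mean value theorem yields different points for the two orders of differentiation; by
    continuity it is enough that both points lie in any given neighborhood of [a]. *)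
Lemma eq_of_near_values (F G : V -> R) a :
  {for a, continuous F} -> {for a, continuous G} ->
  (forall P : V -> Prop, (\forall b \near a, P b) -> exists p q, [/\ P p, P q & F p = G q]) ->
  F a = G a.
Proof.
move=> cF cG H; apply/eqP; rewrite -subr_eq0 -normr_le0; apply/ler_addgt0Pl => /= e e0.
rewrite addr0.
have e20 : 0 < e / 2 by exact: divr_gt0.
have closeF : \forall b \near a, `|F a - F b| < e / 2.
  by move/(@cvgrPdist_lt R R V (nbhs a)): cF; exact.
have closeG : \forall b \near a, `|G a - G b| < e / 2.
  by move/(@cvgrPdist_lt R R V (nbhs a)): cG; exact.
have : \forall b \near a, `|F a - F b| < e / 2 /\ `|G a - G b| < e / 2.
  by apply: filterS2 closeF closeG.
move=> /H[p [q [[Fp _] [_ Gq] E]]].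
rewrite -(subrKA (F p)) [X in _ + (X - _)]E.
by rewrite (le_trans (ler_normD _ _)) // [leRHS]splitr lerD ?ltW // distrC.
Qed.

(** The second difference of [f] is symmetric in the two directions, and divided by [h ^+ 2] it is a
    value of either mixed derivative at a point close to [a]. *)
Lemma partialC f a (i j : 'I_n) : smooth_at a f ->
  partial i (partial j f) a = partial j (partial i f) a.
Proof.
move=> sf; have cont (k l : 'I_n) : {for a, continuous (partial k (partial l f))}.
  exact: smooth_at_cont (smooth_at_partial k (smooth_at_partial l sf)).
apply: (eq_of_near_values (cont i j) (cont j i)) => P Pa.
have [e1 e10 H1] := double_difference j i sf Pa.
have [e2 e20 H2] := double_difference i j sf Pa.
pose h := Num.min e1 e2.
have h0 : 0 < h by rewrite lt_min e10.
have [|p Pp E1] := H1 h h0; first by rewrite ge_min lexx.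
have [|q Pq E2] := H2 h h0; first by rewrite ge_min lexx orbT.
exists p, q; apply: And3 Pp Pq _.
have h20 : h ^+ 2 != 0 by rewrite expf_neq0 ?gt_eqF.
have swap (A B C D : R) : A - B - C + D = A - C - B + D by rewrite (addrAC A).
apply: (mulfI h20 (etrans (esym E1) (etrans _ E2))).
by rewrite [LHS]swap (addrAC a).
Qed.

Lemma dword_rot w i f a : smooth_at a f ->
  \forall b \near a, dword w (partial i f) b = partial i (dword w f) b.
Proof.
move=> sf; elim: w => [|j w IH] /=; first by near=> b.
have := partial_near_eq j IH.
apply: filterS2 (smooth_at_near (smooth_at_dword w sf)) => b sb ->.
exact: partialC.
Unshelve. all: by end_near. Qed.

(** Induction on [w]: its first letter is located in [w'], and [dword_rot] carries the corresponding
    derivative past the letters in front of it. *)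
Lemma dword_perm w w' f a : smooth_at a f -> perm_eq w w' ->
  \forall b \near a, dword w f b = dword w' f b.
Proof.
move=> sf; elim: w w' => [|i w IH] w'.
  by rewrite perm_sym => /perm_nilP ->; near=> b.
move=> iw; have : i \in w' by rewrite -(perm_mem iw) mem_head.
move=> /path.splitPr E; case: E iw => w1 w2 iw.
have : perm_eq w (w1 ++ w2).
  by rewrite -(perm_cons i) (perm_trans iw) // perm_catC /= perm_cons perm_catC.
move=> /IH /(partial_near_eq i) /=.
rewrite !dword_cat /=.
apply: filterS2 (dword_rot w1 i (smooth_at_dword w2 sf)) => b -> ->.
Unshelve. all: by end_near. Qed.

Definition multi_word k (alpha : multi_index k) : seq 'I_n :=
  flatten [seq nseq (val alpha i) i | i <- enum 'I_n].

Lemma dmulti_word k (alpha : multi_index k) f : dmulti alpha f = dword (multi_word alpha) f.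
Proof.
rewrite /dmulti /multi_word; elim: (enum 'I_n) => //= i s ->.
rewrite dword_cat; elim: (val alpha i : nat) => //= m ->.
by [].
Qed.

Lemma size_multi_word k (alpha : multi_index k) : (size (multi_word alpha) <= k)%N.
Proof.
rewrite size_flatten /shape -map_comp (eq_map (g := fun i => val alpha i : nat)).
  by rewrite sumnE big_map big_enum /=; exact: (valP alpha).
by move=> i /=; rewrite size_nseq.
Qed.

Lemma count_multi_word k (alpha : multi_index k) i :
  count_mem i (multi_word alpha) = val alpha i.
Proof.
rewrite /multi_word count_flatten -map_comp sumnE big_map big_enum /=.
rewrite (bigD1 i) //= count_nseq /= eqxx mul1n big1 ?addn0 // => j ji.
by rewrite count_nseq /= (negbTE ji).
Qed.

Lemma sum_count_mem (T : finType) (w : seq T) : \sum_i count_mem i w = size w.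
Proof.
elim: w => [|x w IH] /=; first by rewrite big1.
rewrite big_split /= IH (bigD1 x) //= eqxx big1 // => i.
by rewrite eq_sym => /negbTE ->.
Qed.

Lemma multi_word_onto k w : (size w <= k)%N ->
  exists alpha : multi_index k, perm_eq w (multi_word alpha).
Proof.
(* [inord] truncates nothing here, since no letter occurs more than [size w] times. *)
move=> wk; pose p := [ffun i : 'I_n => inord (count_mem i w) : 'I_k.+1].
have pE i : p i = count_mem i w :> nat.
  by rewrite ffunE inordK // ltnS (leq_trans (count_size _ _)).
have pk : (\sum_i p i <= k)%N by under eq_bigr do rewrite pE; rewrite sum_count_mem.
exists (exist _ p pk); apply/allP => i _ /=.
by rewrite count_multi_word /= pE.
Qed.

Lemma flat_atP k f a : smooth_at a f ->
  flat_at k a f <-> forall alpha : multi_index k, dmulti alpha f a = 0.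
Proof.
move=> sf; split=> [ff alpha|fa w wk].
  by rewrite dmulti_word ff // size_multi_word.
have [alpha wa] := multi_word_onto wk.
by rewrite (nbhs_singleton (dword_perm sf wa)) -dmulti_word.
Qed.

End Schwarz.

(** * Taylor monomials and their derivatives *)

Section Monomials.
Context {R : realType} {n : nat}.
Notation V := 'rV[R]_n.
Implicit Types (a b z : V) (i j : 'I_n) (p : 'I_n -> nat) (w : seq 'I_n).

(** Divided powers: thanks to the factorials a derivative lowers one exponent without a numerical
    factor, so that these functions are dual to the derivatives at [a]. *)
Definition monomial a p : V -> R := fun z => \prod_i ((z 0 i - a 0 i) ^+ p i / (p i)`!%:R).

Lemma smooth_at_shift a i z : smooth_at z (fun z : V => z 0 i - a 0 i).
Proof. by apply: smooth_atD; [exact: smooth_at_coord|exact: smooth_at_cst]. Qed.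

Lemma smooth_at_shiftX a i m z : smooth_at z (fun z : V => (z 0 i - a 0 i) ^+ m).
Proof.
elim: m => [|m IH]; first exact: smooth_at_cst.
apply: smooth_at_eq (smooth_atM (smooth_at_shift a i z) IH).
by near=> y; rewrite exprS.
Unshelve. all: by end_near. Qed.

Lemma smooth_at_monomial a p z : smooth_at z (monomial a p).
Proof.
apply: smooth_at_prod => i _; apply: smooth_atM; [exact: smooth_at_shiftX|exact: smooth_at_cst].
Qed.

Lemma partial_invariant i (f : V -> R) z :
  (forall h : R, f (h *: delta_mx 0 i + z) = f z) -> partial i f z = 0.
Proof.
move=> fi; rewrite /partial /derive.
rewrite (_ : (fun _ => _) = fun=> 0); first exact: lim_cst.
by apply/boolp.funext => h /=; rewrite fi subrr scaler0.
Qed.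

Lemma partial_shiftX a i m z :
  partial i (fun z : V => (z 0 i - a 0 i) ^+ m) z = m%:R * (z 0 i - a 0 i) ^+ m.-1.
Proof.
elim: m => [|m IH]; first by rewrite partial_cst mul0r.
have -> : (fun z : V => (z 0 i - a 0 i) ^+ m.+1) =
   fun z : V => (z 0 i - a 0 i) * (z 0 i - a 0 i) ^+ m.
  by apply/boolp.funext => y; rewrite exprS.
rewrite (partialM i (smooth_at_shift a i z) (smooth_at_shiftX a i m z)) IH.
rewrite (partialD i (smooth_at_coord i z) (smooth_at_cst z _)) partial_coord eqxx.
rewrite partial_cst addr0 mulr1; case: m {IH} => [|m] /=; first by rewrite !mul0r mulr0 add0r mul1r.
by rewrite mulrCA -exprS -[in RHS]addn1 natrD mulrDl mul1r.
Qed.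

Lemma partial_monomial a p i : partial i (monomial a p) =
  if p i is m.+1 then monomial a (fun j => if j == i then m else p j) else fun=> 0.
Proof.
apply/boolp.funext => z.
pose rest (z : V) := \prod_(j | j != i) ((z 0 j - a 0 j) ^+ p j / (p j)`!%:R).
have srest : smooth_at z rest.
  apply: smooth_at_prod => j _; apply: smooth_atM; [exact: smooth_at_shiftX|exact: smooth_at_cst].
have -> : monomial a p = fun z => (p i)`!%:R^-1 * ((z 0 i - a 0 i) ^+ p i * rest z).
  by apply/boolp.funext => y; rewrite /monomial (bigD1 i) //= mulrAC mulrC.
have sX := smooth_at_shiftX a i (p i) z.
rewrite (partialM i (smooth_at_cst z _) (smooth_atM sX srest)) partial_cst mulr0 addr0.
rewrite (partialM i sX srest) partial_shiftX.
rewrite (partial_invariant (f := rest)) ?mulr0 ?add0r; last first.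
  move=> h; apply: eq_bigr => j ji; rewrite !mxE eqxx /=.
  by rewrite (negbTE ji) mulr0 add0r.
case pi: (p i) => [|m] /=; first by rewrite mul0r !mulr0.
rewrite /monomial (bigD1 i) //= eqxx mulrCA mulrC factS natrM invfM.
rewrite -!mulrA [_ * (m.+1%:R * _)]mulrCA !mulrA mulVf ?pnatr_eq0 // mul1r.
rewrite [_^-1 * _]mulrC; congr (_ * _).
by apply: eq_bigr => j /negbTE ->.
Qed.

Lemma dword_monomial a p w :
  dword w (monomial a p) a = [forall i, count_mem i w == p i]%:R.
Proof.
elim/last_ind: w p => [|w i IH] p.
  rewrite /= /monomial; have [/forallP p0|/forallPn[i pi]] := boolP [forall i, 0%N == p i].
    by rewrite big1 // => i _; rewrite -(eqP (p0 i)) expr0 fact0 divr1.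
  rewrite (bigD1 i) //= subrr expr0n eq_sym (negbTE pi) !mul0r //.
rewrite /dword foldr_rcons -/(dword _ _) partial_monomial.
case pi: (p i) => [|m].
  have -> : [forall j, count_mem j (rcons w i) == p j] = false.
    by apply/negbTE/forallPn; exists i; rewrite -cats1 count_cat /= eqxx pi addn1.
  by have := dwordZ w (0 : R) (smooth_at_cst a 0) => /nbhs_singleton; rewrite !mul0r.
rewrite IH; congr (nat_of_bool _)%:R; apply: eq_forallb => j.
rewrite -cats1 count_cat /= addn0 (eq_sym i).
by case: (j =P i) => [->|_]; rewrite ?pi ?addn1 ?addn0.
Qed.

Lemma dword_sum (I : Type) (r : seq I) (C : I -> R) (F : I -> V -> R) w a :
  (forall k, smooth_at a (F k)) ->
  dword w (fun b => \sum_(k <- r) C k * F k b) a = \sum_(k <- r) C k * dword w (F k) a.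
Proof.
move=> sF; elim: r => [|k r IH].
  rewrite (_ : (fun b => _) = fun=> 0); last by apply/boolp.funext => b; rewrite big_nil.
  by rewrite big_nil; exact: (@flat_at_zero _ _ _ a _ (leqnn _)).
rewrite big_cons -IH.
have sCF l : smooth_at a (fun b => C l * F l b) by apply: smooth_atM (smooth_at_cst a _) (sF l).
have srest : smooth_at a (fun b => \sum_(l <- r) C l * F l b) by exact: smooth_at_sum.
rewrite -(nbhs_singleton (dwordZ w (C k) (sF k))) -(nbhs_singleton (dwordD w (sCF k) srest)).
by congr (dword _ _ _); apply/boolp.funext => b; rewrite big_cons.
Qed.

Lemma dmulti_monomial k a (alpha beta : multi_index k) :
  dmulti alpha (monomial a (fun i => val beta i : nat)) a = (alpha == beta)%:R.
Proof.
rewrite dmulti_word dword_monomial; congr (nat_of_bool _)%:R.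
apply/forallP/eqP => [H|-> i]; last by rewrite count_multi_word.
apply: val_inj; apply/ffunP => i; apply: val_inj.
by have /eqP := H i; rewrite count_multi_word.
Qed.

End Monomials.

(** * Functions on manifolds *)

Section ManifoldFunctions.
Context {R : realType} {n : nat} {X : manifold R n}.
Implicit Types (x y : X) (f g : X -> R) (c : @chart R n X) (k : nat).

Section Chart.
Variables (c : @chart R n X) (x : X).
Hypotheses (ac : atlas X c) (cx : cdom c x).

Lemma cmapK : cinv c (cmap c x) = x.
Proof. by case: (atlas_chart ac) => _ _ _ H _; exact: H. Qed.

Lemma cdom_near : \forall y \near x, cdom c y.
Proof. by case: (atlas_chart ac) => oc _ _ _ _; exact: open_nbhs_nbhs. Qed.

Lemma cinv_near (P : X -> Prop) :
  (\forall y \near x, P y) -> \forall a \near cmap c x, P (cinv c a).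
Proof.
move=> Px; case: (atlas_chart ac) => _ _ _ _ ci.
have : {for cmap c x, continuous (cinv c)} by apply: ci; exists x.
rewrite /prop_for /continuous_at cmapK; exact.
Qed.

Lemma cmap_near (P : 'rV[R]_n -> Prop) :
  (\forall a \near cmap c x, P a) -> \forall y \near x, P (cmap c y).
Proof. by move=> Px; case: (atlas_chart ac) => _ _ ci _ _; exact: ci. Qed.

Lemma cinvK_near : \forall a \near cmap c x, cdom c (cinv c a) /\ cmap c (cinv c a) = a.
Proof.
case: (atlas_chart ac) => _ oi _ K _.
apply: (open_near oi); last by exists x.
by move=> _ [y cy <-]; rewrite K.
Qed.

End Chart.

Lemma chart_change c c' x f : atlas X c -> atlas X c' -> cdom c x -> cdom c' x ->
  \forall a \near cmap c' x, ((f \o cinv c) \o (cmap c \o cinv c')) a = (f \o cinv c') a.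
Proof.
move=> ac ac' cx c'x; have := cinv_near ac' c'x (cdom_near ac cx).
by apply: filterS => a /= ca; rewrite (cmapK ac ca).
Qed.

(** Transition maps are smooth, so a test in one chart carries over to all others. *)
Lemma smooth_fun_chart c x f : atlas X c -> cdom c x ->
  smooth_at (cmap c x) (f \o cinv c) -> smooth_fun_at x f.
Proof.
move=> ac cx sf c' ac' c'x; apply: (smooth_at_eq (chart_change f ac ac' cx c'x)).
apply: smooth_at_comp; first by move=> j; exact: (atlas_compatible ac' ac).
by rewrite /= (cmapK ac' c'x).
Qed.

Lemma smooth_fun_eq x f g : (\forall y \near x, f y = g y) ->
  smooth_fun_at x f -> smooth_fun_at x g.
Proof.
move=> fg sf c ac cx; apply: smooth_at_eq (sf c ac cx).
exact: (@cinv_near c x ac cx (fun y => f y = g y) fg).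
Qed.

Lemma smooth_fun_near x f : smooth_fun_at x f -> \forall y \near x, smooth_fun_at y f.
Proof.
move=> sf; have [c ac cx] := atlas_cover x.
have := cmap_near ac cx (smooth_at_near (sf c ac cx)).
apply: filterS2 (cdom_near ac cx) => y cy sy; exact: (smooth_fun_chart ac cy).
Qed.

Lemma smooth_fun_comp_chart c x (h : 'rV[R]_n -> R) : atlas X c -> cdom c x ->
  smooth_at (cmap c x) h -> smooth_fun_at x (h \o cmap c).
Proof.
move=> ac cx sh; apply: (smooth_fun_chart ac cx); apply: smooth_at_eq sh.
by apply: filterS (cinvK_near ac cx) => a [_ E] /=; rewrite E.
Qed.

Lemma smooth_fun_cst x (r : R) : smooth_fun_at x (fun=> r).
Proof. by move=> c _ _; exact: smooth_at_cst. Qed.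

Lemma smooth_funD x f g : smooth_fun_at x f -> smooth_fun_at x g ->
  smooth_fun_at x (fun y => f y + g y).
Proof. by move=> sf sg c ac cx; exact: smooth_atD (sf c ac cx) (sg c ac cx). Qed.

Lemma smooth_funM x f g : smooth_fun_at x f -> smooth_fun_at x g ->
  smooth_fun_at x (fun y => f y * g y).
Proof. by move=> sf sg c ac cx; exact: smooth_atM (sf c ac cx) (sg c ac cx). Qed.

Lemma smooth_funV x f : f x != 0 -> smooth_fun_at x f -> smooth_fun_at x (fun y => (f y)^-1).
Proof.
move=> fx sf c ac cx; apply: (@smooth_atV _ _ (f \o cinv c)) (sf c ac cx).
by rewrite /= (cmapK ac cx).
Qed.

Lemma smooth_fun_sum (I : Type) (r : seq I) (P : pred I) (F : I -> X -> R) x :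
  (forall i, P i -> smooth_fun_at x (F i)) ->
  smooth_fun_at x (fun y => \sum_(i <- r | P i) F i y).
Proof.
by move=> sF c ac cx;
  apply: (@smooth_at_sum R n I r P (fun i => F i \o cinv c) (cmap c x)) => i Pi; exact: sF.
Qed.

Lemma smooth_fun_prod (I : Type) (r : seq I) (P : pred I) (F : I -> X -> R) x :
  (forall i, P i -> smooth_fun_at x (F i)) ->
  smooth_fun_at x (fun y => \prod_(i <- r | P i) F i y).
Proof.
by move=> sF c ac cx;
  apply: (@smooth_at_prod R n I r P (fun i => F i \o cinv c) (cmap c x)) => i Pi; exact: sF.
Qed.

Lemma smooth_fun_neq0 x f : smooth_fun_at x f -> f x != 0 -> \forall y \near x, f y != 0.
Proof.
move=> sf fx0; have [c ac cx] := atlas_cover x.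
have fcx : (f \o cinv c) (cmap c x) != 0 by rewrite /= (cmapK ac cx).
have H : \forall a \near cmap c x, (f \o cinv c) a != 0.
  exact: (@cvgr_neq0 R R _ (nbhs (cmap c x)) _ (f \o cinv c) _ (smooth_at_cont (sf c ac cx)) fcx).
have := cmap_near ac cx H; apply: filterS2 (cdom_near ac cx) => y cy /=.
by rewrite (cmapK ac cy).
Qed.

Lemma smooth_fun_det m (H : X -> 'M[R]_m) x :
  (forall i j, smooth_fun_at x (fun y => H y i j)) -> smooth_fun_at x (fun y => \det (H y)).
Proof.
move=> sH; rewrite /determinant; apply: smooth_fun_sum => s _.
by apply: smooth_funM; [exact: smooth_fun_cst|apply: smooth_fun_prod].
Qed.

Lemma unitmx_near m (H : X -> 'M[R]_m) x :
  (forall i j, smooth_fun_at x (fun y => H y i j)) -> H x \in unitmx ->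
  \forall y \near x, H y \in unitmx.
Proof.
move=> /smooth_fun_det sd; rewrite unitmxE unitfE => /(smooth_fun_neq0 sd).
by apply: filterS => y; rewrite unitmxE unitfE.
Qed.

(** Cramer's rule: the entries of the inverse are cofactors divided by the determinant, which stays
    nonzero near [x]. *)
Lemma smooth_fun_invmx m (H : X -> 'M[R]_m) x :
  (forall i j, smooth_fun_at x (fun y => H y i j)) -> H x \in unitmx ->
  forall i j, smooth_fun_at x (fun y => invmx (H y) i j).
Proof.
move=> sH Hx i j.
have : smooth_fun_at x (fun y => (\det (H y))^-1 * ((-1) ^+ (j + i) * \det (row' j (col' i (H y))))).
  apply: smooth_funM.
    by apply: smooth_funV; [rewrite -unitfE -unitmxE|exact: smooth_fun_det].
  apply: smooth_funM; first exact: smooth_fun_cst.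
  apply: smooth_fun_det => k l; apply: smooth_fun_eq (sH (lift j k) (lift i l)).
  by near=> y; rewrite !mxE.
apply: smooth_fun_eq; apply: filterS (unitmx_near sH Hx) => y Hy.
by rewrite /invmx Hy !mxE.
Unshelve. all: by end_near. Qed.

Definition flat_fun k x f :=
  forall c, atlas X c -> cdom c x -> flat_at k (cmap c x) (f \o cinv c).

Lemma flat_fun_chart c k x f : atlas X c -> cdom c x -> smooth_fun_at x f ->
  flat_at k (cmap c x) (f \o cinv c) -> flat_fun k x f.
Proof.
move=> ac cx sf ff c' ac' c'x; apply: (flat_at_eq (chart_change f ac ac' cx c'x)).
by apply: flat_at_comp; rewrite /= ?(cmapK ac' c'x) //;
  [move=> j; exact: (atlas_compatible ac' ac)|exact: sf].
Qed.

Lemma flat_fun_eq k x f g : (\forall y \near x, f y = g y) -> flat_fun k x f -> flat_fun k x g.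
Proof.
move=> fg ff c ac cx; apply: flat_at_eq (ff c ac cx).
exact: (@cinv_near c x ac cx (fun y => f y = g y) fg).
Qed.

Lemma flat_funM k x f g : smooth_fun_at x f -> smooth_fun_at x g ->
  flat_fun k x f -> flat_fun k x (fun y => f y * g y).
Proof. by move=> sf sg ff c ac cx; exact: flat_atM (sf c ac cx) (sg c ac cx) (ff c ac cx). Qed.

Lemma flat_funD k x f g : smooth_fun_at x f -> smooth_fun_at x g ->
  flat_fun k x f -> flat_fun k x g -> flat_fun k x (fun y => f y + g y).
Proof.
move=> sf sg ff fg c ac cx.
exact: flat_atD (sf c ac cx) (sg c ac cx) (ff c ac cx) (fg c ac cx).
Qed.

Lemma flat_fun_sum (I : Type) (r : seq I) (P : pred I) (F : I -> X -> R) k x :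
  (forall i, P i -> smooth_fun_at x (F i)) -> (forall i, P i -> flat_fun k x (F i)) ->
  flat_fun k x (fun y => \sum_(i <- r | P i) F i y).
Proof.
move=> sF fF c ac cx; apply: (@flat_at_sum R n I r P (fun i => F i \o cinv c) k (cmap c x)) => i Pi.
  exact: sF.
exact: fF.
Qed.

Lemma flat_fun_zero k x : flat_fun k x (fun=> 0).
Proof. by move=> c _ _; exact: flat_at_zero. Qed.

End ManifoldFunctions.

(** * Trivializations and sections *)

Lemma linear_fun0 (R : pzRingType) (U V : lmodType R) (f : U -> V) : linear f -> f 0 = 0.
Proof. by move=> /(_ (-1) 0 0); rewrite scaler0 addr0 scaleN1r addNr. Qed.

Lemma linear_funB (R : pzRingType) (U V : lmodType R) (f : U -> V) (u v : U) :
  linear f -> f (u - v) = f u - f v.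
Proof. by move=> lf; rewrite addrC -scaleN1r lf scaleN1r addrC. Qed.

Section Trivializations.
Context {R : realType} {n : nat} {X : manifold R n}.
Implicit Types (x y : X) (k : nat).

(* The vector with coordinates [c]; it is [0] if there is none. *)
Definition tinv (fib : X -> lmodType R) (t : trivialization fib) y (c : tidx t -> R) : fib y :=
  xget 0 [set u : fib y | forall i, tmap t u i = c i].

Section Linear.
Context {fib : X -> lmodType R} {t : trivialization fib}.
Hypothesis tt : is_trivialization t.

Lemma tdom_near x : tdom t x -> \forall y \near x, tdom t y.
Proof. by case: tt => ot _ tx; apply: (@open_nbhs_nbhs X x (tdom t)). Qed.

Variable y : X.
Hypothesis ty : tdom t y.
Implicit Types (e u v : fib y) (i : tidx t).

Lemma tmap_lin a u v i : tmap t (a *: u + v) i = a * tmap t u i + tmap t v i.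
Proof. by case: tt => _ /(_ y ty)[H _]; exact: H. Qed.

Lemma tmap0 i : tmap t (0 : fib y) i = 0.
Proof. by have := tmap_lin (-1) 0 0 i; rewrite scaler0 addr0 mulN1r addNr. Qed.

Lemma tmapZ a u i : tmap t (a *: u) i = a * tmap t u i.
Proof. by rewrite -[a *: u]addr0 tmap_lin tmap0 addr0. Qed.

Lemma tmapD u v i : tmap t (u + v) i = tmap t u i + tmap t v i.
Proof. by rewrite -[u]scale1r tmap_lin mul1r scale1r. Qed.

Lemma tmapB u v i : tmap t (u - v) i = tmap t u i - tmap t v i.
Proof. by rewrite tmapD -scaleN1r tmapZ mulN1r. Qed.

Lemma tmap_sum (I : Type) (r : seq I) (P : pred I) (F : I -> fib y) i :
  tmap t (\sum_(k <- r | P k) F k) i = \sum_(k <- r | P k) tmap t (F k) i.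
Proof. by apply: (big_morph (fun u => tmap t u i)) => [u v|]; rewrite ?tmapD ?tmap0. Qed.

Lemma tmap_inj u v : (forall i, tmap t u i = tmap t v i) -> u = v.
Proof.
case: tt => _ /(_ y ty)[_ /bij_inj inj] uv; apply: inj; exact/boolp.funext.
Qed.

Lemma tinvK (c : tidx t -> R) i : tmap t (tinv y c) i = c i.
Proof.
rewrite /tinv; have := @xgetPex _ (0 : fib y) [set u : fib y | forall i, tmap t u i = c i].
apply; case: tt => _ /(_ y ty)[_ [g _ gK]]; exists (g c) => j.
exact: (congr1 (fun h => h j) (gK c)).
Qed.

Lemma tmap_delta u : u = \sum_i tmap t u i *: tinv y (fun j => (i == j)%:R).
Proof.
apply: tmap_inj => j; rewrite tmap_sum (bigD1 j) //= tmapZ tinvK eqxx mulr1 big1 ?addr0 //.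
by move=> i ij; rewrite tmapZ tinvK (negbTE ij) mulr0.
Qed.

End Linear.

Lemma bijective_choice (A B : Type) (f : A -> B) :
  injective f -> (forall b, exists a, f a = b) -> bijective f.
Proof.
move=> fi fs; have [g gK] := boolp.choice fs.
by exists g => // a; apply: fi; rewrite gK.
Qed.

(* The basis vectors of [t] are combinations of the frame [s] with the entries of
   the inverse of its matrix of coordinates as coefficients.  For jet bundles
   this replaces the explicit transformation law of higher derivatives. *)
Lemma smooth_in_frame (fib fib' : X -> lmodType R)
    (t : trivialization fib) (t' : trivialization fib')
    (f : forall y, fib y -> fib' y) :
  is_trivialization t -> is_trivialization t' -> (forall y, linear (f y)) ->
  (forall x, tdom t x -> tdom t' x -> exists s : tidx t -> forall y, fib y,
    [/\ forall b i, smooth_fun_at x (fun y => tmap t (s b y) i),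
        forall b i, tmap t (s b x) i = (b == i)%:R &
        forall b j, smooth_fun_at x (fun y => tmap t' (f y (s b y)) j)]) ->
  smooth_in t t' f.
Proof.
move=> Tt Tt' lf H.
have f_sum y (I : Type) (r : seq I) (a : I -> R) (F : I -> fib y) j : tdom t' y ->
    tmap t' (f y (\sum_(k <- r) a k *: F k)) j = \sum_(k <- r) a k * tmap t' (f y (F k)) j.
  move=> ty'; elim: r => [|b r IH].
    by rewrite !big_nil linear_fun0 // tmap0.
  by rewrite !big_cons lf tmap_lin // IH.
(* The matrix of [f] is forced: its entries are the coordinates of the images of the basis vectors
   of [t]. Only their smoothness is at stake. *)
exists (fun i j y => tmap t' (f y (tinv y (fun j => (i == j)%:R))) j) => x tx t'x.
split=> [i j|e j]; last first.
  rewrite {1}(tmap_delta Tt tx e) f_sum //.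
  by apply: eq_bigr => i _; rewrite mulrC.
have [s [ss s1 ss']] := H x tx t'x.
pose S y : 'M[R]_#|tidx t| := \matrix_(b, k) tmap t (s (enum_val b) y) (enum_val k).
have sS (b k : 'I_#|tidx t|) : smooth_fun_at x (fun y => S y b k).
  by apply: smooth_fun_eq (ss (enum_val b) (enum_val k)); near=> y; rewrite mxE.
(* At [x] the frame is the basis of [t], so its matrix is the identity there and remains invertible
   nearby. *)
have Sx : S x \in unitmx.
  rewrite (_ : S x = 1%:M) ?unitmx1 //; apply/matrixP => b k.
  by rewrite !mxE s1 (inj_eq enum_val_inj).
have : smooth_fun_at x (fun y =>
    \sum_b invmx (S y) (enum_rank i) b * tmap t' (f y (s (enum_val b) y)) j).
  apply: smooth_fun_sum => b _; apply: smooth_funM (ss' _ _).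
  exact: smooth_fun_invmx.
apply: smooth_fun_eq; near=> y.
have ty : tdom t y by near: y; exact: tdom_near.
have ty' : tdom t' y by near: y; exact: tdom_near.
have Sy : S y \in unitmx by near: y; exact: unitmx_near.
rewrite -f_sum //; congr (tmap t' (f y _) j); apply: (tmap_inj Tt ty) => k.
rewrite (tmap_sum Tt ty) (tinvK Tt ty).
have /matrixP/(_ (enum_rank i) (enum_rank k)) := mulVmx Sy.
rewrite !mxE (inj_eq enum_rank_inj) => <-; apply: eq_bigr => b _.
by rewrite (tmapZ Tt ty) mxE enum_rankK.
Unshelve. all: by end_near. Qed.

End Trivializations.

Section Sections.
Context {R : realType} {n : nat} {X : manifold R n}.
Implicit Types (E F : bundle X) (x y : X) (k : nat).

(** The first axiom of a vector bundle by itself. The cokernel satisfies it by construction, whereas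
    a cover by trivializations depends on the rank of the map. *)
Definition linear_bundle E := forall t, trivs E t -> is_trivialization t.

Lemma vector_bundle_linear E : vector_bundle E -> linear_bundle E.
Proof. by case. Qed.

Lemma smooth_section_eq E x (s s' : section E) : (\forall y \near x, s y = s' y) ->
  smooth_section_at x s -> smooth_section_at x s'.
Proof.
move=> ss' sm t Et tx i; apply: smooth_fun_eq (sm t Et tx i).
by apply: filterS ss' => y ->.
Qed.

(** Passes from derivatives taken in a fixed order to all words of derivatives, which is legitimate
    on smooth germs by [flat_atP]. *)
Lemma vanishesP E k x (s : section E) : smooth_section_at x s ->
  vanishes k x s <-> forall t, trivs E t -> tdom t x ->
    forall i, flat_fun k x (fun y => tmap t (s y) i).
Proof.
move=> ss; split=> [vs t Et tx i c ac cx|vs t c Et ac tx cx i alpha].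
  by apply/flat_atP; [exact: ss|move=> alpha; exact: vs].
by have /flat_atP := vs t Et tx i c ac cx; apply; exact: ss.
Qed.

Lemma vanishes_eq E k x (s s' : section E) : smooth_section_at x s ->
  (\forall y \near x, s y = s' y) -> vanishes k x s -> vanishes k x s'.
Proof.
move=> sm ss' /(vanishesP _ sm) vs; apply/vanishesP; first exact: smooth_section_eq sm.
move=> t Et tx i; apply: flat_fun_eq (vs t Et tx i).
by apply: filterS ss' => y ->.
Qed.

Section LinearBundle.
Variable E : bundle X.
Hypothesis linE : linear_bundle E.
Implicit Types (s : section E).

Lemma smooth_section0 x : smooth_section_at x (0 : section E).
Proof.
move=> t Et tx i; apply: smooth_fun_eq (@smooth_fun_cst R n X x 0).
by apply: filterS (tdom_near (linE Et) tx) => y ty; rewrite (tmap0 (linE Et) ty).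
Qed.

Lemma smooth_section_lin x a s s' : smooth_section_at x s -> smooth_section_at x s' ->
  smooth_section_at x (a *: s + s').
Proof.
move=> ss ss' t Et tx i.
have := smooth_funD (smooth_funM (@smooth_fun_cst R n X x a) (ss t Et tx i)) (ss' t Et tx i).
apply: smooth_fun_eq; apply: filterS (tdom_near (linE Et) tx) => y ty.
by rewrite (tmap_lin (linE Et) ty).
Qed.

Lemma smooth_sectionB x s s' : smooth_section_at x s -> smooth_section_at x s' ->
  smooth_section_at x (s - s').
Proof.
by move=> ss ss'; rewrite -[s]addr0 addrC -scaleN1r addrA addr0; apply: smooth_section_lin.
Qed.

Lemma smooth_submodule x : submodule [set s : section E | smooth_section_at x s].
Proof.
by split; [exact: smooth_section0|move=> a u v; exact: smooth_section_lin].
Qed.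

Lemma vanishes_lin k x a s s' : smooth_section_at x s -> smooth_section_at x s' ->
  vanishes k x s -> vanishes k x s' -> vanishes k x (a *: s + s').
Proof.
move=> ss ss' /(vanishesP _ ss) vs /(vanishesP _ ss') vs'.
apply/vanishesP; first exact: smooth_section_lin.
move=> t Et tx i; have sa := @smooth_fun_cst R n X x a.
have := flat_funD (smooth_funM (ss t Et tx i) sa) (ss' t Et tx i)
  (flat_funM (ss t Et tx i) sa (vs t Et tx i)) (vs' t Et tx i).
apply: flat_fun_eq; apply: filterS (tdom_near (linE Et) tx) => y ty.
by rewrite (tmap_lin (linE Et) ty) mulrC.
Qed.

Lemma vanishes0 k x : vanishes k x (0 : section E).
Proof.
apply/vanishesP; first exact: smooth_section0.
move=> t Et tx i; apply: flat_fun_eq (@flat_fun_zero R n X k x).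
by apply: filterS (tdom_near (linE Et) tx) => y ty; rewrite (tmap0 (linE Et) ty).
Qed.

Lemma vanishes_submodule k x :
  submodule [set s : section E | smooth_section_at x s /\ vanishes k x s].
Proof.
split; first by split; [exact: smooth_section0|exact: vanishes0].
move=> a u v [su vu] [sv vv].
by split; [exact: smooth_section_lin|exact: vanishes_lin].
Qed.

(** The smooth sections vanishing to order [k] at [x] form a submodule, so the span taken in the
    quotient adds nothing to them. *)
Lemma jet_eq k x s s' : smooth_section_at x s -> smooth_section_at x s' ->
  jet k s x = jet k s' x <-> vanishes k x (s - s').
Proof.
move=> ss ss'; rewrite /jet qclassP; do ?exact: sub_lspan.
rewrite lspan_id; last exact: vanishes_submodule.
by split=> [[]|] //; split=> //; exact: smooth_sectionB.
Qed.

Lemma jet_near_eq k x s s' : smooth_section_at x s ->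
  (\forall y \near x, s y = s' y) -> jet k s x = jet k s' x.
Proof.
move=> ss ss'; apply/jet_eq => //; first exact: smooth_section_eq ss.
apply: (vanishes_eq _ _ (@vanishes0 k x)); first exact: smooth_section0.
by apply: filterS ss' => y E'; rewrite -[RHS]/(s y - s' y) E' subrr.
Qed.

Lemma jet_zero k x s : smooth_section_at x s -> jet k s x = 0 <-> vanishes k x s.
Proof.
move=> ss; have -> : 0 = jet k (0 : section E) x by [].
rewrite jet_eq ?subr0 //; exact: smooth_section0.
Qed.

Lemma jet_lin k x a s s' : smooth_section_at x s -> smooth_section_at x s' ->
  jet k (a *: s + s') x = a *: jet k s x + jet k s' x.
Proof. by move=> ss ss'; rewrite /jet qclass_linear //; exact: sub_lspan. Qed.

Lemma smooth_qrepr k x (u : jet_bundle k E x) : smooth_section_at x (qrepr u).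
Proof.
have := qrepr_lspan u; rewrite lspan_id //; exact: smooth_submodule.
Qed.

Lemma jet_qrepr k x (u : jet_bundle k E x) : jet k (qrepr u) x = u.
Proof. exact: qreprK. Qed.

Lemma vanishes_qrepr k x s : smooth_section_at x s -> vanishes k x (qrepr (jet k s x) - s).
Proof. by move=> ss; apply/jet_eq; rewrite ?jet_qrepr //; exact: smooth_qrepr. Qed.

End LinearBundle.

Section VectorBundle.
Variable E : bundle X.
Hypothesis vbE : vector_bundle E.
Implicit Types (s : section E).

Lemma smooth_section_triv x t s : trivs E t -> tdom t x ->
  (forall i, smooth_fun_at x (fun y => tmap t (s y) i)) -> smooth_section_at x s.
Proof.
case: vbE => linE _ trE Et tx ss t' Et' t'x j; have [g gE] := trE t t' Et Et'.
have [sg _] := gE x tx t'x.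
have : smooth_fun_at x (fun y => \sum_i g i j y * tmap t (s y) i).
  by apply: smooth_fun_sum => i _; apply: smooth_funM.
apply: smooth_fun_eq.
apply: filterS2 (tdom_near (linE t Et) tx) (tdom_near (linE t' Et') t'x) => y ty t'y.
by have [_ ->] := gE y ty t'y.
Qed.

Lemma smooth_section_near x s : smooth_section_at x s ->
  \forall y \near x, smooth_section_at y s.
Proof.
case: (vbE) => linE /(_ x)[t Et tx] _ ss.
have : \forall y \near x, forall i, smooth_fun_at y (fun y => tmap t (s y) i).
  by apply: near_forall => i; apply: smooth_fun_near; exact: ss.
apply: filterS2 (tdom_near (linE t Et) tx) => y ty sy; exact: smooth_section_triv ty sy.
Qed.

Lemma vanishes_triv k x t s : smooth_section_at x s -> trivs E t -> tdom t x ->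
  (forall i, flat_fun k x (fun y => tmap t (s y) i)) -> vanishes k x s.
Proof.
case: (vbE) => linE _ trE ss Et tx fs; apply/(vanishesP _ ss) => t' Et' t'x j.
have [g gE] := trE t t' Et Et'; have [sg _] := gE x tx t'x.
have : flat_fun k x (fun y => \sum_i tmap t (s y) i * g i j y).
  apply: flat_fun_sum => i _; first by apply: smooth_funM => //; exact: ss.
  by apply: flat_funM => //; exact: ss.
apply: flat_fun_eq.
apply: filterS2 (tdom_near (linE t Et) tx) (tdom_near (linE t' Et') t'x) => y ty t'y.
by have [_ ->] := gE y ty t'y; apply: eq_bigr => i _; rewrite mulrC.
Qed.

End VectorBundle.

Section BundleMap.
Variables (E F : bundle X) (f : forall x, E x -> F x).
Hypotheses (vbE : vector_bundle E) (linF : linear_bundle F) (bf : bundle_map f).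
Implicit Types (s : section E).

Lemma bundle_map_smooth x s : smooth_section_at x s ->
  smooth_section_at x ((fun y => f (s y)) : section F).
Proof.
case: (vbE) => linE /(_ x)[t Et tx] _ ss t' Ft' t'x j.
have [g gE] := bf.2 t t' Et Ft'; have [sg _] := gE x tx t'x.
have : smooth_fun_at x (fun y => \sum_i g i j y * tmap t (s y) i).
  by apply: smooth_fun_sum => i _; apply: smooth_funM => //; exact: ss.
apply: smooth_fun_eq.
apply: filterS2 (tdom_near (linE t Et) tx) (tdom_near (linF Ft') t'x) => y ty t'y.
by have [_ ->] := gE y ty t'y.
Qed.

Lemma bundle_map_vanishes k x s : smooth_section_at x s -> vanishes k x s ->
  vanishes k x ((fun y => f (s y)) : section F).
Proof.
move=> ss /(vanishesP _ ss) vs; apply/vanishesP; first exact: bundle_map_smooth.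
case: (vbE) => linE /(_ x)[t Et tx] _ t' Ft' t'x j.
have [g gE] := bf.2 t t' Et Ft'; have [sg _] := gE x tx t'x.
have : flat_fun k x (fun y => \sum_i tmap t (s y) i * g i j y).
  apply: flat_fun_sum => i _; first by apply: smooth_funM => //; exact: ss.
  by apply: flat_funM (vs t Et tx i) => //; exact: ss.
apply: flat_fun_eq.
apply: filterS2 (tdom_near (linE t Et) tx) (tdom_near (linF Ft') t'x) => y ty t'y.
by have [_ ->] := gE y ty t'y; apply: eq_bigr => i _; rewrite mulrC.
Qed.

(** The representative picked by [jet_map] differs from [s] by a section vanishing to order [r], and
    [f], being linear with smooth coefficients, preserves this order. *)
Lemma jet_map_jet r x s : smooth_section_at x s ->
  jet_map f (jet r s x) = jet r ((fun y => f (s y)) : section F) x.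
Proof.
move=> ss; have linE := vector_bundle_linear vbE.
have sq := smooth_qrepr linE (jet r s x).
apply/jet_eq => //; try exact: bundle_map_smooth.
have := bundle_map_vanishes (smooth_sectionB linE sq ss) (@vanishes_qrepr E linE r x s ss).
apply: vanishes_eq; first by apply: bundle_map_smooth; exact: smooth_sectionB.
by near=> y; exact: (linear_funB (qrepr (jet r s x) y) (s y) (bf.1 y)).
Unshelve. all: by end_near. Qed.

End BundleMap.

End Sections.

(** * Jet bundles *)

Section JetBundles.
Context {R : realType} {n : nat} {X : manifold R n}.
Implicit Types (E F : bundle X) (x y : X) (k l q r : nat).

Lemma local_coord_smooth E t c (s : section E) i x : trivs E t -> tdom t x ->
  atlas X c -> cdom c x -> smooth_section_at x s ->
  smooth_at (cmap c x) (local_coord t c s i).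
Proof. by move=> Et tx ac cx ss; exact: ss. Qed.

Lemma local_coord_near_lin E t c a (s s' : section E) i x : is_trivialization t ->
  tdom t x -> atlas X c -> cdom c x ->
  \forall b \near cmap c x,
    a * local_coord t c s i b + local_coord t c s' i b = local_coord t c (a *: s + s') i b.
Proof.
move=> Tt tx ac cx; have := cinv_near ac cx (tdom_near Tt tx).
by apply: filterS => b tb; rewrite /local_coord -(tmap_lin Tt tb).
Qed.

Lemma dmulti_local_coord_lin E k (alpha : multi_index k) t c a (s s' : section E) i x :
  linear_bundle E -> trivs E t -> tdom t x -> atlas X c -> cdom c x ->
  smooth_section_at x s -> smooth_section_at x s' ->
  dmulti alpha (local_coord t c (a *: s + s') i) (cmap c x) =
  a * dmulti alpha (local_coord t c s i) (cmap c x) +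
  dmulti alpha (local_coord t c s' i) (cmap c x).
Proof.
move=> linE Et tx ac cx ss ss'; rewrite !dmulti_word.
have H := local_coord_near_lin a s s' i (linE _ Et) tx ac cx.
rewrite -(nbhs_singleton (dword_near_eq (multi_word alpha) H)).
have sm := local_coord_smooth i Et tx ac cx ss.
have sm' := local_coord_smooth i Et tx ac cx ss'.
have D := dwordD (multi_word alpha) (smooth_atM (smooth_at_cst (cmap c x) a) sm) sm'.
have Z := dwordZ (multi_word alpha) a sm.
by rewrite (nbhs_singleton D) (nbhs_singleton Z).
Qed.

(** The coordinates are computed on a chosen representative; its difference with [s] has zero
    derivatives at [x] up to order [k]. *)
Lemma jet_coord E k t c (s : section E) ai x : linear_bundle E ->
  trivs E t -> tdom t x -> atlas X c -> cdom c x -> smooth_section_at x s ->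
  tmap (jet_triv k t c) (jet k s x) ai = dmulti ai.1 (local_coord t c s ai.2) (cmap c x).
Proof.
move=> linE Et tx ac cx ss; rewrite /jet_triv /=.
have sq := smooth_qrepr linE (jet k s x).
have := dmulti_local_coord_lin ai.1 (-1) ai.2 linE Et tx ac cx ss sq.
rewrite scaleN1r addrC (vanishes_qrepr linE ss) // mulN1r addrC => /eqP.
by rewrite eq_sym subr_eq0 => /eqP.
Qed.

(* The section whose Taylor coefficients at [x], in the chart [c], are [C]. *)
Definition monomial_section E (t : trivialization E) (c : @chart R n X) x k
    (C : multi_index (n := n) k * tidx t -> R) : section E :=
  fun y => tinv y (fun i => \sum_beta C (beta, i) *
    monomial (cmap c x) (fun j => val beta j : nat) (cmap c y)).

Section VectorBundle.
Variable E : bundle X.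
Hypothesis vbE : vector_bundle E.
Let linE := vector_bundle_linear vbE.
Implicit Types (s : section E).

Lemma monomial_section_coord t c x k (C : multi_index (n := n) k * tidx t -> R) i : trivs E t -> tdom t x ->
  atlas X c -> cdom c x ->
  \forall b \near cmap c x,
    \sum_(beta : multi_index k) C (beta, i) * monomial (cmap c x) (fun j => val beta j : nat) b =
    local_coord t c (@monomial_section E t c x k C) i b.
Proof.
move=> Et tx ac cx; have := cinv_near ac cx (tdom_near (linE Et) tx).
apply: filterS2 (cinvK_near ac cx) => b [_ cb] tb.
by rewrite /local_coord /monomial_section (tinvK (linE Et) tb) cb.
Qed.

Lemma monomial_section_smooth t c x k C : trivs E t -> tdom t x ->
  atlas X c -> cdom c x -> smooth_section_at x (@monomial_section E t c x k C).
Proof.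
move=> Et tx ac cx; apply: (smooth_section_triv vbE Et tx) => i.
apply: (smooth_fun_chart ac cx).
apply: smooth_at_eq (monomial_section_coord C i Et tx ac cx) _.
apply: smooth_at_sum => beta _.
by apply: smooth_atM; [exact: smooth_at_cst|exact: smooth_at_monomial].
Qed.

Lemma dmulti_monomial_section t c x k C (alpha : multi_index k) i :
  trivs E t -> tdom t x -> atlas X c -> cdom c x ->
  dmulti alpha (local_coord t c (@monomial_section E t c x k C) i) (cmap c x) = C (alpha, i).
Proof.
move=> Et tx ac cx; rewrite dmulti_word.
have H := monomial_section_coord C i Et tx ac cx.
rewrite -(nbhs_singleton (dword_near_eq (multi_word alpha) H)).
rewrite dword_sum => [|beta]; last exact: smooth_at_monomial.
rewrite (bigD1 alpha) //= -dmulti_word dmulti_monomial eqxx mulr1 big1 ?addr0 //.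
by move=> beta ba; rewrite -dmulti_word dmulti_monomial eq_sym (negbTE ba) mulr0.
Qed.

Lemma vanishes_local_coord k x s t c : smooth_section_at x s ->
  trivs E t -> tdom t x -> atlas X c -> cdom c x ->
  (forall i (alpha : multi_index k), dmulti alpha (local_coord t c s i) (cmap c x) = 0) ->
  vanishes k x s.
Proof.
move=> ss Et tx ac cx v; apply: (vanishes_triv vbE ss Et tx) => i.
apply: (flat_fun_chart ac cx); first exact: ss.
by apply/flat_atP; [exact: ss|exact: v].
Qed.

(** Injectivity holds because one chart and one trivialization decide whether a section vanishes to
    order [k]; surjectivity, because Taylor polynomials have prescribed derivatives. *)
Lemma jet_triv_is_trivialization k t c : trivs E t -> atlas X c ->
  is_trivialization (jet_triv k t c).
Proof.
move=> Et ac; split.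
  by apply: openI; [case: (linE Et)|case: (atlas_chart ac)].
move=> x [tx cx].
have lin i : scalar (fun e : jet_bundle k E x => tmap (jet_triv k t c) e i).
  move=> a u v; have su := smooth_qrepr linE u; have sv := smooth_qrepr linE v.
  rewrite -{1}(jet_qrepr u) -{1}(jet_qrepr v) -jet_lin //.
  rewrite (jet_coord _ linE) //; last exact: smooth_section_lin.
  by rewrite (dmulti_local_coord_lin i.1 a i.2 linE Et tx ac cx su sv).
split=> //; apply: bijective_choice => [u v uv|C].
  have su := smooth_qrepr linE u; have sv := smooth_qrepr linE v.
  rewrite -(jet_qrepr u) -(jet_qrepr v); apply/jet_eq => //.
  apply: (vanishes_local_coord _ Et tx ac cx); first exact: smooth_sectionB.
  move=> i alpha; have := dmulti_local_coord_lin alpha (-1) i linE Et tx ac cx sv su.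
  rewrite scaleN1r addrC => ->; rewrite mulN1r addrC; apply/eqP; rewrite subr_eq0.
  by apply/eqP; exact: (congr1 (fun h => h (alpha, i)) uv).
exists (jet k (monomial_section c x C) x); apply/boolp.funext => -[alpha i].
rewrite (jet_coord _ linE) //; last exact: monomial_section_smooth.
exact: dmulti_monomial_section.
Qed.

Lemma jet_linear_bundle k : linear_bundle (jet_bundle k E).
Proof. by move=> _ [t [c [Et ac ->]]]; exact: jet_triv_is_trivialization. Qed.

Lemma jet_coord_near k x s t c ai : smooth_section_at x s ->
  trivs E t -> tdom t x -> atlas X c -> cdom c x ->
  \forall y \near x, dmulti ai.1 (local_coord t c s ai.2) (cmap c y) =
    tmap (jet_triv k t c) (jet k s y) ai.
Proof.
move=> ss Et tx ac cx; near=> y.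
rewrite (jet_coord _ linE) //.
- by near: y; exact: (tdom_near (linE Et)).
- by near: y; exact: cdom_near.
- by near: y; exact: smooth_section_near.
Unshelve. all: by end_near. Qed.

Lemma jet_smooth k x s : smooth_section_at x s ->
  smooth_section_at x (jet k s : section (jet_bundle k E)).
Proof.
move=> ss _ [t [c [Et ac ->]]] [tx cx] ai.
apply: smooth_fun_eq (jet_coord_near ai ss Et tx ac cx) _.
apply: (smooth_fun_comp_chart ac cx (h := dmulti ai.1 (local_coord t c s ai.2))).
by rewrite dmulti_word; apply: smooth_at_dword; exact: ss.
Qed.

(** The jets of the sections with a single Taylor coefficient 1 at [x] form the frame required by
    [smooth_in_frame]. Hence smoothness of a map out of a jet bundle need only be tested on jets of
    sections; for the identity map this gives the transition functions. *)
Lemma jet_smooth_in (fib : X -> lmodType R) k (t' : trivialization fib)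
    (f : forall x, jet_bundle k E x -> fib x) :
  is_trivialization t' -> (forall x, linear (f x)) ->
  (forall x s, tdom t' x -> smooth_section_at x s ->
     forall j, smooth_fun_at x (fun y => tmap t' (f y (jet k s y)) j)) ->
  forall t, trivs (jet_bundle k E) t -> smooth_in t t' f.
Proof.
move=> Tt' lf sf T ET; have [t [c [Et ac TE]]] := ET; rewrite {}TE in ET *.
apply: smooth_in_frame (jet_linear_bundle ET) Tt' lf _ => x [tx cx] t'x.
pose C (ai bi : multi_index (n := n) k * tidx t) : R := (ai == bi)%:R.
exists (fun ai => jet k (monomial_section c x (C ai))).
have sm ai := monomial_section_smooth (C ai) Et tx ac cx.
split=> [ai i|ai [alpha i]|ai j].
- by apply: (jet_smooth (sm ai)).
- by rewrite (jet_coord _ linE) // dmulti_monomial_section.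
- exact: sf.
Qed.

Lemma jet_vector_bundle k : vector_bundle (jet_bundle k E).
Proof.
split; first exact: jet_linear_bundle.
  move=> x; have [_ /(_ x)[t Et tx] _] := vbE; have [c ac cx] := atlas_cover x.
  by exists (jet_triv k t c) => //; exists t, c.
move=> t t' Et Et'; apply: jet_smooth_in Et => //; first exact: jet_linear_bundle.
by move=> x s t'x ss j; exact: (jet_smooth ss).
Qed.

(** The coordinates of [jet q s] are the derivatives of [s] along words of length at most [q], and
    differentiating them at most [r] times concatenates words. The reverse implication is the
    injectivity of the inclusion of [J_(q+r)(E)] in [J_r(J_q(E))]. *)
Lemma vanishes_jet q r x s : smooth_section_at x s ->
  vanishes (q + r) x s <-> vanishes r x (jet q s : section (jet_bundle q E)).
Proof.
move=> ss; have sj := jet_smooth (k := q) ss.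
have [t Et tx] : exists2 t, trivs E t & tdom t x by case: vbE.
have [c ac cx] := atlas_cover x.
have near_coord alpha i : \forall b \near cmap c x,
    dword (multi_word alpha) (local_coord t c s i) b =
    tmap (jet_triv q t c) (jet q s (cinv c b)) (alpha, i).
  have := cinv_near ac cx (jet_coord_near (alpha, i) ss Et tx ac cx).
  by apply: filterS2 (cinvK_near ac cx) => b [_ cb] <- /=; rewrite cb dmulti_word.
split=> [/(vanishesP _ ss) vs|/(vanishesP _ sj) vs].
  apply: (vanishes_triv (jet_vector_bundle q) sj (t := jet_triv q t c)) => //.
    by exists t, c.
  move=> [alpha i]; apply: (flat_fun_chart ac cx).
    by apply: sj => //; exists t, c.
  apply: flat_at_eq (near_coord alpha i) _ => w wr.
  rewrite -dword_cat; apply: (vs t Et tx i c ac cx).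
  by rewrite size_cat addnC leq_add ?size_multi_word.
apply: (vanishes_triv vbE ss Et tx) => i; apply: (flat_fun_chart ac cx); first exact: ss.
(* The last letters act first: the final [q] of them, or all if [w] is shorter, select a jet
   coordinate up to reordering, and the at most [r] remaining ones differentiate it. *)
move=> w wqr; rewrite -(cat_take_drop (size w - q) w) dword_cat.
have [alpha wa] : exists alpha : multi_index q, perm_eq (drop (size w - q) w) (multi_word alpha).
  by apply: multi_word_onto; rewrite size_drop leq_subLR addnC -maxnE leq_maxr.
have sl := local_coord_smooth i Et tx ac cx ss.
have H : \forall b \near cmap c x, dword (drop (size w - q) w) (local_coord t c s i) b =
    tmap (jet_triv q t c) (jet q s (cinv c b)) (alpha, i).
  by apply: filterS2 (dword_perm sl wa) (near_coord alpha i) => b -> ->.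
have {}vs := vs (jet_triv q t c) _ (conj tx cx) (alpha, i) c ac cx.
rewrite (nbhs_singleton (dword_near_eq _ H)); apply: vs; first by exists t, c.
by rewrite size_takel ?leq_subr // leq_subLR.
Qed.

Lemma jet_incl_jet q r x s : smooth_section_at x s ->
  jet_incl (jet (q + r) s x) = jet r (jet q s : section (jet_bundle q E)) x.
Proof.
move=> ss; have sq := smooth_qrepr linE (jet (q + r) s x).
have sB := smooth_sectionB linE sq ss.
apply/jet_eq; [exact: jet_linear_bundle|exact: jet_smooth|exact: jet_smooth|].
have := (vanishes_jet q r sB).1 (@vanishes_qrepr _ _ _ _ linE (q + r) x s ss).
apply: vanishes_eq; first exact: jet_smooth.
have := smooth_section_near vbE ss.
apply: filterS2 (smooth_section_near vbE sq) => y sqy sy.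
have := jet_lin q (-1) sy sqy; rewrite scaleN1r addrC => ->.
by rewrite scaleN1r addrC.
Qed.

Section Prolongation.
Variables (F : bundle X) (q : nat) (Phi : forall x, jet_bundle q E x -> F x).
Hypotheses (linF : linear_bundle F) (bPhi : bundle_map Phi).

Lemma prolong_section_smooth x s : smooth_section_at x s ->
  smooth_section_at x ((fun y => @Phi y (jet q s y)) : section F).
Proof.
move=> ss; apply: (bundle_map_smooth (jet_vector_bundle q) linF bPhi).
exact: jet_smooth.
Qed.

Lemma prolong_jet r x s : smooth_section_at x s ->
  prolong r Phi x (jet (q + r) s x) = jet r ((fun y => @Phi y (jet q s y)) : section F) x.
Proof.
move=> ss; rewrite /prolong jet_incl_jet //.
by rewrite (jet_map_jet (jet_vector_bundle q) linF bPhi) //; exact: jet_smooth.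
Qed.

Lemma prolong_linear r x : linear (prolong r Phi x).
Proof.
move=> a u v; have su := smooth_qrepr linE u; have sv := smooth_qrepr linE v.
rewrite -{1}(jet_qrepr u) -{1}(jet_qrepr v) -jet_lin //.
rewrite -{2}(jet_qrepr u) -{2}(jet_qrepr v) !prolong_jet //; last exact: smooth_section_lin.
rewrite -jet_lin; do ?exact: prolong_section_smooth.
apply: (jet_near_eq linF); first by apply: prolong_section_smooth; exact: smooth_section_lin.
have := smooth_section_near vbE su.
apply: filterS2 (smooth_section_near vbE sv) => y svy suy.
by rewrite jet_lin // bPhi.1.
Qed.

End Prolongation.

End VectorBundle.

(** On jets of sections the prolongation is the [r]-jet of [Phi (j_q s)], which is smooth, and such
    jets suffice by [jet_smooth_in]. *)
Lemma prolong_bundle_map r E F q (Phi : forall x, jet_bundle q E x -> F x) :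
  vector_bundle E -> vector_bundle F -> bundle_map Phi -> bundle_map (prolong r Phi).
Proof.
move=> vbE vbF bPhi; have linF := vector_bundle_linear vbF.
have lin x : linear (prolong r Phi x) by exact: prolong_linear.
split=> // t t' Et Ft'; apply: (jet_smooth_in vbE) Et => //.
  exact: (jet_linear_bundle vbF) Ft'.
move=> x s t'x ss.
have := jet_smooth vbF (k := r) (prolong_section_smooth vbE linF bPhi ss) Ft' t'x.
move=> sm j; apply: smooth_fun_eq (sm j).
apply: filterS (smooth_section_near vbE ss) => y sy.
by rewrite (prolong_jet vbE linF bPhi).
Qed.

End JetBundles.

(** * Cokernels of bundle maps of locally constant rank *)

Section LinearAlgebra.
Variable K : fieldType.

(** Rank-nullity for row vectors, with [z] a basis of the kernel. A frame of a subbundle keeps the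
    same index type at all nearby points, so this expresses the rank by a number independent of the
    point. *)
Lemma kernel_frame_rank m p (A : 'M[K]_(m, p)) (I : finType) (z : I -> 'rV[K]_m) :
  (forall w : 'rV[K]_m, w *m A = 0 <-> exists c : I -> K, w = \sum_i c i *: z i) ->
  injective (fun c : I -> K => \sum_i c i *: z i) ->
  \rank A = (m - #|I|)%N.
Proof.
move=> kerA inj; pose Z : 'M[K]_(#|I|, m) := \matrix_(a < #|I|) z (enum_val a).
have mulZ (v : 'rV[K]_#|I|) : v *m Z = \sum_i v 0 (enum_rank i) *: z i.
  rewrite mulmx_sum_row (reindex_onto (@enum_rank I) (@enum_val I predT)) /=; last first.
    by move=> a _; exact: enum_valK.
  by apply: eq_big => [i|i _]; rewrite ?enum_rankK ?eqxx // rowK enum_rankK.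
have Zfree : row_free Z.
  apply: inj_row_free => v; rewrite mulZ => v0; apply/rowP => a; rewrite mxE.
  have : (fun i => v 0 (enum_rank i)) = (fun=> 0).
    by apply: inj; rewrite v0 big1 // => i _; rewrite scale0r.
  by move=> /(congr1 (fun h => h (enum_val a))); rewrite enum_valK.
have ZkerA : (Z :=: kermx A)%MS.
  apply/eqmxP/andP; split.
    apply/sub_kermxP/row_matrixP => a; rewrite row_mul row0 rowK; apply/kerA.
    exists (fun i => (i == enum_val a)%:R); rewrite (bigD1 (enum_val a)) //= eqxx scale1r.
    by rewrite big1 ?addr0 // => i /negbTE ->; rewrite scale0r.
  apply/rV_subP => w /sub_kermxP /kerA[c ->]; apply/submxP.
  exists (\row_a c (enum_val a)); rewrite mulZ; apply: eq_bigr => i _.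
  by rewrite mxE enum_rankK.
have := mxrank_ker A; rewrite -ZkerA => rk; move: Zfree; rewrite /row_free rk => /eqP <-.
by rewrite subKn // rank_leq_row.
Qed.

Lemma copid_mxE m p r (w : 'M[K]_(m, p)) i j :
  (w *m copid_mx r) i j = if (j < r)%N then 0 else w i j.
Proof.
rewrite mulmxBr mulmx1 !mxE (bigD1 j) //= big1 => [|k kj]; last first.
  by rewrite [pid_mx _ _ _]mxE (inj_eq val_inj) (negbTE kj) mulr0.
rewrite [pid_mx _ _ _]mxE eqxx addr0 /=; case: ifP => _; first by rewrite mulr1 subrr.
by rewrite mulr0 subr0.
Qed.

Section Complement.
Variables (m p r : nat) (A : 'M[K]_(m, p)).

(* When [A] is the value at a point near [x] of a family with [A x = pid_mx r],
   this family of matrices is the identity at [x].  Where it is invertible and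
   [A] has rank [r], the last [p - r] coordinates of [v *m invmx completion]
   vanish exactly when [v] is in the row space of [A]. *)
Definition completion : 'M[K]_p := (pid_mx r : 'M[K]_(p, m)) *m A + copid_mx r.

Hypotheses (rp : (r <= p)%N) (rkA : \rank A = r).
Hypothesis unitA : completion \in unitmx.

Lemma copid_completion : copid_mx r *m completion = copid_mx r.
Proof.
rewrite mulmxDr copid_mx_id // mulmxA mulmxBl mul1mx mul_pid_mx minnn.
by rewrite (minn_idPr rp) subrr mul0mx add0r.
Qed.

Lemma pid_completion : (pid_mx r : 'M[K]_p) *m completion = (pid_mx r : 'M[K]_(p, m)) *m A.
Proof.
rewrite mulmxDr mulmxA mul_pid_mx minnn (minn_idPr rp).
by rewrite mulmxBr mulmx1 mul_pid_mx minnn (minn_idPr rp) subrr addr0.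
Qed.

Lemma copid_invmx : copid_mx r *m invmx completion = copid_mx r.
Proof. by rewrite -{1}copid_completion -mulmxA mulmxV ?mulmx1. Qed.

(** The first [r] rows of [completion] are rows of [A] and are independent; as [A] has rank [r],
    they span its row space. Membership thus means that the coordinates relative to the other rows
    vanish. *)
Lemma row_space_complement (v : 'rV[K]_p) :
  (v <= A)%MS = (v *m invmx completion *m copid_mx r == 0).
Proof.
have eqA : (pid_mx r : 'M[K]_(p, m)) *m A = (pid_mx r : 'M[K]_p) *m completion.
  by rewrite pid_completion.
have rk : \rank ((pid_mx r : 'M[K]_(p, m)) *m A) = r.
  by rewrite eqA mxrankMfree ?row_free_unit // rank_pid_mx.
have sub : ((pid_mx r : 'M[K]_(p, m)) *m A :=: A)%MS.
  by apply/eqmxP; rewrite submxMl /= -(geq_leqif (mxrank_leqif_sup (submxMl _ _))) rk rkA.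
rewrite -sub eqA; apply/idP/eqP => [/submxP[w ->]|v0].
  rewrite !mulmxA mulmxK //.
  by rewrite -mulmxA mulmxBr mulmx1 mul_pid_mx minnn (minn_idPr rp) subrr mulmx0.
have := mulmx1 (v *m invmx completion); rewrite -[1%:M](subrK (pid_mx r)) mulmxDr.
rewrite -/(copid_mx r) v0 add0r => vE; apply/submxP; exists (v *m invmx completion).
by rewrite mulmxA vE mulmxKV.
Qed.

End Complement.

Lemma completion_normal_form m p (A : 'M[K]_(m, p)) :
  completion (\rank A) (invmx (col_ebase A) *m A *m invmx (row_ebase A)) = 1%:M.
Proof.
rewrite -{3}(mulmx_ebase A) -!mulmxA mulmxV ?row_ebase_unit // mulmx1.
rewrite mulKmx ?col_ebase_unit // /completion mul_pid_mx minnn.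
by rewrite (minn_idPr (rank_leq_row A)) addrC subrK.
Qed.

End LinearAlgebra.

Section Cokernel.
Context {R : realType} {n : nat} {X : manifold R n}.
Variables (G F : bundle X) (f : forall x, G x -> F x).
Arguments f : clear implicits.
Hypotheses (linf : forall x, linear (f x)).
Implicit Types (x y : X) (k : nat).

Lemma coker_linear_bundle : linear_bundle (coker f).
Proof. by move=> t []. Qed.

Lemma coker_proj_linear x : linear (coker_proj f x).
Proof. by move=> a u v; apply: qclass_linear; exact: sub_lspan. Qed.

Lemma coker_proj_bundle_map : bundle_map (coker_proj f).
Proof.
split; first exact: coker_proj_linear.
by move=> t t' Ft [_]; apply.
Qed.

Lemma im_submodule x : submodule (im_map f x).
Proof.
split; first by exists 0; rewrite ?linear_fun0.
by move=> a _ _ [u _ <-] [v _ <-]; exists (a *: u + v); rewrite ?linf.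
Qed.

Lemma coker_proj_eq x u v : coker_proj f x u = coker_proj f x v <-> im_map f x (u - v).
Proof.
rewrite /coker_proj /coker_proj_fun qclassP; do ?exact: sub_lspan.
by rewrite lspan_id //; exact: im_submodule.
Qed.

Lemma coker_proj_eq0 x v : coker_proj f x v = 0 <-> im_map f x v.
Proof.
have -> : (0 : coker f x) = coker_proj f x 0 by rewrite linear_fun0 //; exact: coker_proj_linear.
by rewrite coker_proj_eq subr0.
Qed.

Lemma ker_coker_proj x : ker_map (coker_proj f) x = range (f x).
Proof. by apply/seteqP; split=> v; [move=> /coker_proj_eq0|move=> ?; apply/coker_proj_eq0]. Qed.

Lemma coker_proj_qrepr x (C : coker f x) : coker_proj f x (qrepr C) = C.
Proof. exact: qreprK. Qed.

End Cokernel.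

Section CokernelTrivialization.
Context {R : realType} {n : nat} {X : manifold R n}.
Variables (G F : bundle X) (f : forall x, G x -> F x).
Arguments f : clear implicits.
Hypotheses (vbG : vector_bundle G) (vbF : vector_bundle F) (bf : bundle_map f).
Hypothesis kerf : subbundle (ker_map f).
Let linf : forall x, linear (f x) := bf.1.
Let linF := vector_bundle_linear vbF.
Let linG := vector_bundle_linear vbG.

Definition coord_row (E : bundle X) (t : trivialization E) y (v : E y) : 'rV[R]_#|tidx t| :=
  \row_j tmap t v (enum_val j).

Lemma coord_row_lin (E : bundle X) (t : trivialization E) y a (u v : E y) :
  is_trivialization t -> tdom t y ->
  coord_row t (a *: u + v) = a *: coord_row t u + coord_row t v.
Proof. by move=> Tt ty; apply/rowP => j; rewrite !mxE (tmap_lin Tt ty). Qed.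

Lemma coord_row_inj (E : bundle X) (t : trivialization E) y :
  is_trivialization t -> tdom t y -> injective (coord_row t (y := y)).
Proof.
move=> Tt ty u v /rowP uv; apply: (tmap_inj Tt ty) => i.
by have := uv (enum_rank i); rewrite !mxE enum_rankK.
Qed.

Lemma coord_row_tinv (E : bundle X) (t : trivialization E) y (w : 'rV[R]_#|tidx t|) :
  is_trivialization t -> tdom t y ->
  coord_row t (tinv y (fun i => w 0 (enum_rank i)) : E y) = w.
Proof. by move=> Tt ty; apply/rowP => j; rewrite mxE (tinvK Tt ty) enum_valK. Qed.

(* In bases adapted to [f x], the last coordinates after multiplication by the
   inverse of [completion] trivialize the cokernel. *)
Lemma coker_frame x : exists2 t, trivs (coker f) t /\ tdom t x &
  exists s : tidx t -> section F, (forall l, smooth_section_at x (s l)) /\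
    \forall y \near x, forall l l', tmap t (coker_proj f y (s l y)) l' = (l == l')%:R.
Proof.
have [tG GtG tGx] : exists2 t, trivs G t & tdom t x by case: vbG.
have [tF FtF tFx] : exists2 t, trivs F t & tdom t x by case: vbF.
have TG := linG GtG; have TF := linF FtF.
have [g gE] := bf.2 tG tF GtG FtF.
pose m := #|tidx tG|; pose p := #|tidx tF|.
pose M y : 'M[R]_(m, p) := \matrix_(i, j) g (enum_val i) (enum_val j) y.
have MP y (u : G y) : tdom tG y -> tdom tF y ->
    coord_row tF (f y u) = coord_row tG u *m M y.
  move=> Gy Fy; apply/rowP => j; rewrite !mxE; have [_ ->] := gE y Gy Fy.
  rewrite (reindex_onto (@enum_val _ predT) enum_rank) /=; last first.
    by move=> i _; exact: enum_rankK.
  by apply: eq_big => [i|i _]; rewrite ?enum_valK ?eqxx // !mxE mulrC.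
have sM y i j : tdom tG y -> tdom tF y -> smooth_fun_at y (fun z => M z i j).
  move=> Gy Fy; have [sg _] := gE y Gy Fy.
  by apply: smooth_fun_eq (sg (enum_val i) (enum_val j)); near=> z; rewrite mxE.
have [I [e [_ eI]]] := kerf x.
(* Regularity acts here: the kernel has a frame indexed by the same [I] at all points near [x]. *)
have rkM : \forall y \near x, \rank (M y) = (m - #|I|)%N.
  near=> y.
  have Gy : tdom tG y by near: y; exact: tdom_near.
  have Fy : tdom tF y by near: y; exact: tdom_near.
  have [kE inj] : ker_map f y = range (fun c : I -> R => \sum_i c i *: e i y) /\
      injective (fun c : I -> R => \sum_i c i *: e i y) by near: y.
  have row_sum (c : I -> R) : coord_row tG (\sum_i c i *: e i y) =
      \sum_i c i *: coord_row tG (e i y).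
    apply/rowP => j; rewrite !mxE (tmap_sum TG Gy) summxE; apply: eq_bigr => i _.
    by rewrite (tmapZ TG Gy) !mxE.
  apply: (kernel_frame_rank (z := fun i => coord_row tG (e i y))) => [w|c c' cc'].
    rewrite -(coord_row_tinv w TG Gy); set u := tinv _ _.
    rewrite -(MP y u Gy Fy); split=> [fu0|[c uc]].
      have : ker_map f y u.
        apply: (coord_row_inj TF Fy); rewrite fu0.
        by apply/rowP => j; rewrite !mxE (tmap0 TF Fy).
      by rewrite kE => -[c _ <-]; exists c; rewrite row_sum.
    have : ker_map f y u.
      by rewrite kE; exists c => //; apply: (coord_row_inj TG Gy); rewrite row_sum uc.
    by rewrite /ker_map /= => ->; apply/rowP => j; rewrite !mxE (tmap0 TF Fy).
  by apply: inj; apply: (coord_row_inj TG Gy); rewrite !row_sum.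
pose r := \rank (M x).
have {}rkM : \forall y \near x, \rank (M y) = r.
  by have := nbhs_singleton rkM; rewrite -/r => ->.
pose L := col_ebase (M x); pose U := row_ebase (M x).
have uL : L \in unitmx by exact: col_ebase_unit.
have uU : U \in unitmx by exact: row_ebase_unit.
pose A y := invmx L *m M y *m invmx U.
pose H y := completion r (A y).
have rp : (r <= p)%N by exact: rank_leq_col.
have sA y i j : tdom tG y -> tdom tF y -> smooth_fun_at y (fun z => A z i j).
  move=> Gy Fy.
  have : smooth_fun_at y (fun z => \sum_k (\sum_l invmx L i l * M z l k) * invmx U k j).
    apply: smooth_fun_sum => k _; apply: smooth_funM; last exact: smooth_fun_cst.
    by apply: smooth_fun_sum => l _; apply: smooth_funM; [exact: smooth_fun_cst|exact: sM].
  by apply: smooth_fun_eq; near=> z; rewrite mxE; apply: eq_bigr => k _; rewrite mxE.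
have sH y i j : tdom tG y -> tdom tF y -> smooth_fun_at y (fun z => H z i j).
  move=> Gy Fy.
  have : smooth_fun_at y (fun z => \sum_k (pid_mx r : 'M[R]_(p, m)) i k * A z k j +
      (copid_mx r : 'M[R]_p) i j).
    apply: smooth_funD; last exact: smooth_fun_cst.
    by apply: smooth_fun_sum => k _; apply: smooth_funM; [exact: smooth_fun_cst|exact: sA].
  by apply: smooth_fun_eq; near=> z; rewrite [RHS]mxE; congr (_ + _); rewrite mxE.
have uHx : H x \in unitmx by rewrite /H /A completion_normal_form unitmx1.
have : \forall y \near x, [/\ tdom tG y, tdom tF y, \rank (M y) = r & H y \in unitmx].
  near=> y; split; near: y; [exact: tdom_near|exact: tdom_near|exact: rkM|].
  by apply: unitmx_near => // i j; exact: sH.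
move=> /near_open[D [oD Dx] HD].
(* The coordinates of [v] relative to the rows of [H y *m U]: the first [r] rows span the image of
   [f y], the others a complement of it. *)
pose K y (v : F y) : 'rV[R]_p := coord_row tF v *m invmx U *m invmx (H y).
have Klin y a (u v : F y) : D y -> K y (a *: u + v) = a *: K y u + K y v.
  by move=> /HD[_ Fy _ _]; rewrite /K (coord_row_lin a u v TF Fy) !mulmxDl -!scalemxAl.
have KB y (u v : F y) j : D y -> K y (u - v) 0 j = K y u 0 j - K y v 0 j.
  by move=> Dy; rewrite addrC -scaleN1r Klin // [LHS]mxE [X in X + _]mxE mulN1r addrC.
have Kim y (v : F y) : D y -> im_map f y v <-> forall j : 'I_p, (r <= j)%N -> K y v 0 j = 0.
  move=> /HD[Gy Fy rky uHy].
  have rkA : \rank (A y) = r.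
    by rewrite mxrankMfree ?row_free_unit ?unitmx_inv // (eqmxMfull _ _) ?row_full_unit ?unitmx_inv.
  have E : (forall j : 'I_p, (r <= j)%N -> K y v 0 j = 0) <-> (coord_row tF v *m invmx U <= A y)%MS.
    rewrite (row_space_complement rp rkA uHy); split=> [v0|/eqP/rowP v0 j rj].
      apply/eqP/rowP => j; rewrite copid_mxE [RHS]mxE; case: ltnP => // rj; exact: v0.
    by have := v0 j; rewrite copid_mxE [RHS]mxE ltnNge rj.
  rewrite E; split=> [[u _ <-]|/submxP[w wE]].
    rewrite (MP y u Gy Fy); apply/submxP; exists (coord_row tG u *m L).
    by rewrite /A !mulmxA mulmxK.
  have uE := coord_row_tinv (w *m invmx L) TG Gy.
  set u := tinv y _ in uE; exists u => //; apply: (coord_row_inj TF Fy).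
  rewrite (MP y u Gy Fy) uE -[RHS](mulmxKV uU) wE /A !mulmxA mulmxKV //.
(* The choice of representative is harmless by [tQE]: two of them differ by an element of the image,
   whose coordinates from [r] on are zero. *)
pose tQ : trivialization (coker f) := @Trivialization R n X (coker f) {j : 'I_p | (r <= j)%N} D
  (fun y (C : coker f y) j => K y (qrepr C) 0 (val j)).
have tQE y (v : F y) l : D y -> tmap tQ (coker_proj f y v) l = K y v 0 (val l).
  move=> Dy; rewrite /=; set v' := qrepr _.
  have : im_map f y (v' - v) by apply/(coker_proj_eq linf); exact: coker_proj_qrepr.
  move=> /(Kim _ _ Dy) /(_ _ (valP l)).
  by rewrite KB // => /eqP; rewrite subr_eq0 => /eqP.
have TQ : is_trivialization tQ.
  split=> // y Dy; have [Gy Fy _ uHy] := HD y Dy; split=> [l a C C'|].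
    rewrite -{1}(coker_proj_qrepr C) -{1}(coker_proj_qrepr C') -coker_proj_linear tQE //.
    by rewrite Klin // [LHS]mxE [X in X + _]mxE.
  apply: bijective_choice => [C C' CC'|c].
    rewrite -(coker_proj_qrepr C) -(coker_proj_qrepr C'); apply/(coker_proj_eq linf).
    apply/(Kim _ _ Dy) => j rj; rewrite KB //.
    have := congr1 (fun h => h (exist _ j rj)) CC'; rewrite /= => ->.
    by rewrite subrr.
  (* The coordinates below [r] lie along the image and do not affect the class; they are set to
     0. *)
  pose w : 'rV[R]_p := \row_j (if insub j is Some l then c l else 0).
  exists (coker_proj f y (tinv y (fun i => (w *m H y *m U) 0 (enum_rank i)))).
  apply/boolp.funext => l; rewrite tQE // /K (coord_row_tinv _ TF Fy) mulmxK // mulmxK //.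
  by rewrite mxE valK.
exists tQ.
  split=> //; split=> // t' Ft'; have [h hE] := (let: And3 _ _ H := vbF in H) t' tF Ft' FtF.
  exists (fun i l y => \sum_(j < p) h i (enum_val j) y * (invmx U *m invmx (H y)) j (val l)).
  move=> y t'y Dy; have [Gy Fy _ uHy] := HD y Dy; have [sh hE'] := hE y t'y Fy; split=> [i l|v l].
    apply: smooth_fun_sum => j _; apply: smooth_funM; first exact: sh.
    have : smooth_fun_at y (fun z => \sum_k invmx U j k * invmx (H z) k (val l)).
      apply: smooth_fun_sum => k _; apply: smooth_funM; first exact: smooth_fun_cst.
      by apply: smooth_fun_invmx => // i' j'; exact: sH.
    by apply: smooth_fun_eq; near=> z; rewrite mxE.
  rewrite tQE // /K -mulmxA mxE; under eq_bigr do rewrite mxE hE' mulr_suml.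
  rewrite exchange_big /=; apply: eq_bigr => i _; rewrite mulr_suml; apply: eq_bigr => j _.
  by rewrite mulrAC.
(* The lifts are the rows of [U] from index [r] on, constant in the trivialization [tF]. As
   [completion] has unit vectors as its rows there, they lift the basis at every point of [D] and
   not just at [x]. *)
exists (fun l y => tinv y (fun i => (row (val l) U) 0 (enum_rank i))); split=> [l|].
  apply: (smooth_section_triv vbF FtF tFx) => i.
  apply: smooth_fun_eq (@smooth_fun_cst R n X x ((row (val l) U) 0 (enum_rank i))).
  by apply: filterS (tdom_near TF tFx) => y Fy; rewrite (tinvK TF Fy).
have Dnear : \forall y \near x, D y by exact: (@open_nbhs_nbhs X x D).
apply: filterS Dnear => y Dy l l'; have [_ Fy _ uHy] := HD y Dy.
have row_copid : row (val l) (1%:M : 'M[R]_p) = row (val l) (copid_mx r : 'M[R]_p).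
  have rl : (r <= val (val l))%N := valP l.
  by apply/rowP => j; rewrite !mxE [(_ < r)%N]ltnNge rl andbF subr0.
rewrite tQE // /K (coord_row_tinv _ TF Fy) -row_mul mulmxV // row_copid -row_mul.
rewrite copid_invmx // -row_copid !mxE; congr (nat_of_bool _)%:R; exact: val_eqE.
Unshelve. all: by end_near. Qed.

Lemma lift_mod_image x k (s0 : section F) : smooth_section_at x s0 ->
  vanishes k x ((fun y => coker_proj f y (s0 y)) : section (coker f)) ->
  exists s1 : section F, [/\ smooth_section_at x s1,
    \forall y \near x, im_map f y (s1 y) & vanishes k x (s0 - s1)].
Proof.
move=> ss0 v0; have linQ := coker_linear_bundle (f := f).
have bQ := coker_proj_bundle_map f.
have sQ := bundle_map_smooth vbF linQ bQ ss0.
have [t [Qt tx] [s [ss st]]] := coker_frame x.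
have Tt := linQ t Qt.
pose kap l y := tmap t (coker_proj f y (s0 y)) l.
have skap l : smooth_fun_at x (kap l) by exact: sQ.
have fkap l : flat_fun k x (kap l) by exact: (vanishesP k sQ).1.
(* The coefficients [kap l] are flat at [x] and remain so when multiplied by smooth functions, so
   [d] vanishes to order [k] although the lifts [s l] do not. *)
pose d : section F := fun y => \sum_l kap l y *: s l y.
have dE t' : trivs F t' -> tdom t' x -> forall i,
    \forall y \near x, \sum_l kap l y * tmap t' (s l y) i = tmap t' (d y) i.
  move=> Ft' t'x i; apply: filterS (tdom_near (linF Ft') t'x) => y t'y.
  rewrite (tmap_sum (linF Ft') t'y); apply: eq_bigr => l _.
  by rewrite (tmapZ (linF Ft') t'y).
have sd : smooth_section_at x d.
  move=> t' Ft' t'x i; apply: smooth_fun_eq (dE t' Ft' t'x i) _.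
  by apply: smooth_fun_sum => l _; apply: smooth_funM => //; exact: ss.
have vd : vanishes k x d.
  apply/(vanishesP _ sd) => t' Ft' t'x i; apply: flat_fun_eq (dE t' Ft' t'x i) _.
  apply: flat_fun_sum => l _; first by apply: smooth_funM => //; exact: ss.
  by apply: flat_funM => //; exact: ss.
exists (s0 - d); split; last by rewrite opprB addrC subrK.
  exact: smooth_sectionB.
have := tdom_near Tt tx; apply: filterS2 st => y sty ty.
apply/(coker_proj_eq0 linf); apply: (tmap_inj Tt ty) => l.
have -> : coker_proj f y ((s0 - d) y) = coker_proj f y (s0 y) - coker_proj f y (d y).
  exact: (linear_funB (s0 y) (d y) (@coker_proj_linear R n X G F f y)).
rewrite (tmapB Tt ty) (tmap0 Tt ty) {1}/d.
have lin_sum (r : seq (tidx t)) : tmap t (coker_proj f y (\sum_(l <- r) kap l y *: s l y)) l =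
    \sum_(l' <- r) kap l' y * (l' == l)%:R.
  elim: r => [|l' r IH].
    by rewrite !big_nil (linear_fun0 (@coker_proj_linear R n X G F f y)) (tmap0 Tt ty).
  by rewrite !big_cons coker_proj_linear (tmap_lin Tt ty) IH sty.
rewrite lin_sum (bigD1 l) //= eqxx mulr1 big1 ?addr0 ?subrr // => l' /negbTE ->.
by rewrite mulr0.
Qed.

End CokernelTrivialization.

(** * Compatibility conditions *)

Section CompatibilityConditions.
Context {R : realType} {n : nat} {X : manifold R n}.
Variables (E F : bundle X) (q : nat) (Phi : forall x, jet_bundle q E x -> F x).
Arguments Phi : clear implicits.
Hypotheses (vbE : vector_bundle E) (vbF : vector_bundle F) (bPhi : bundle_map Phi).
Implicit Types (x y : X) (r : nat).
Let linE := vector_bundle_linear vbE.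
Let linF := vector_bundle_linear vbF.

Lemma ker_coker_prolong r x :
  ker_map (coker_proj (prolong r Phi)) x = range (prolong r Phi x).
Proof. by apply: ker_coker_proj => y; exact: (prolong_linear vbE linF bPhi). Qed.

Lemma prolong_coker_jet r x (t : section F) : smooth_section_at x t ->
  prolong 1 (coker_proj (prolong r Phi)) x (jet (r + 1)%N t x) =
  jet 1 ((fun y => coker_proj (prolong r Phi) y (jet r t y))
    : section (coker (prolong r Phi))) x.
Proof.
move=> st; apply: (prolong_jet vbF) st; first exact: coker_linear_bundle.
exact: coker_proj_bundle_map.
Qed.

Lemma coker_jet_smooth r x (t : section F) : smooth_section_at x t ->
  smooth_section_at x ((fun y => coker_proj (prolong r Phi) y (jet r t y))
    : section (coker (prolong r Phi))).
Proof.
move=> st; apply: (bundle_map_smooth (jet_vector_bundle vbF r)).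
- exact: coker_linear_bundle.
- exact: coker_proj_bundle_map.
- exact: jet_smooth.
Qed.

Lemma ker_coker_sub_ker_prolong r x :
  ker_map (coker_proj (prolong (r + 1)%N Phi)) x `<=`
  ker_map (prolong 1 (coker_proj (prolong r Phi))) x.
Proof.
rewrite ker_coker_prolong => _ [w _ <-]; rewrite -(jet_qrepr w).
have sw := smooth_qrepr linE w.
have linQ := coker_linear_bundle (f := prolong r Phi).
have sPhi := prolong_section_smooth vbE linF bPhi sw.
have E1 := prolong_jet vbE linF bPhi (r + 1)%N sw.
have E2 := prolong_coker_jet r sPhi.
apply: (etrans (congr1 (prolong 1 (coker_proj (prolong r Phi)) x) E1)).
apply: (etrans E2).
apply/(jet_zero linQ); first exact: coker_jet_smooth.
(* The single section [qrepr w] provides preimages at all nearby points, so the class is zero as a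
   germ and not merely at [x]. *)
have H : \forall y \near x, (0 : section (coker (prolong r Phi))) y =
    coker_proj (prolong r Phi) y (jet r ((fun z => Phi z (jet q (qrepr w) z)) : section F) y).
  apply: filterS (smooth_section_near vbE sw) => y sy.
  apply/esym; have E3 := prolong_jet vbE linF bPhi r sy.
  apply: (etrans (congr1 (coker_proj (prolong r Phi) y) (esym E3))).
  apply/coker_proj_eq0; first by move=> z; exact: (prolong_linear vbE linF bPhi).
  by exists (jet (q + r)%N (qrepr w) y).
apply: (vanishes_eq _ H); first exact: smooth_section0.
exact: vanishes0.
Qed.

Lemma ker_prolong_coker r x : subbundle (ker_map (prolong r Phi)) ->
  ker_map (prolong 1 (coker_proj (prolong r Phi))) x =
  prolong_sub (im_map (prolong r Phi)) x.
Proof.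
move=> kerP; have linQ := coker_linear_bundle (f := prolong r Phi).
have linJ := jet_linear_bundle vbF (k := r).
have vbJ := jet_vector_bundle vbF r.
have bQ := coker_proj_bundle_map (prolong r Phi).
apply/seteqP; split=> u; rewrite -(jet_qrepr u); have su := smooth_qrepr linF u.
all: have sj := jet_smooth vbF (k := r) su.
all: rewrite /ker_map /prolong_sub /jet1_sub /= (prolong_coker_jet r su) (jet_incl_jet vbF r 1 su).
all: have sC : smooth_section_at x ((fun y => coker_proj (prolong r Phi) y (jet r (qrepr u) y))
  : section (coker (prolong r Phi))) by exact: coker_jet_smooth.
  move=> /(jet_zero linQ 1 sC) v0.
  have [s1 [ss1 ims1 v1]] := lift_mod_image (jet_vector_bundle vbE (q + r)) vbJ
    (prolong_bundle_map r vbE vbF bPhi) kerP sj v0.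
  exists s1; first by split.
  by apply/esym; apply/(jet_eq linJ).
(* Conversely, projecting the difference of the two sections preserves its first-order vanishing,
   and the class of [s] is zero near [x], which leaves the class of the jet. *)
move=> [s [ss ims]] /esym /(jet_eq linJ 1 sj ss) vs.
apply/(jet_zero linQ 1 sC).
have sB := smooth_sectionB linJ sj ss.
apply: vanishes_eq (bundle_map_vanishes vbJ linQ bQ sB vs).
  exact: (bundle_map_smooth vbJ linQ bQ).
have linP z : linear (prolong r Phi z) by exact: (prolong_linear vbE linF bPhi).
apply: filterS ims => y /(coker_proj_eq0 linP) s0.
have linC := @coker_proj_linear R n X _ _ (prolong r Phi) y.
apply: (etrans (linear_funB (jet r (qrepr u) y) (s y) linC)).
exact: (etrans (congr1 (fun z => _ - z) s0) (subr0 _)).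
Qed.

End CompatibilityConditions.

(** * Strictness of the inclusion: the identity of a jet bundle as an operator *)

Lemma subbundle_zero (R : realType) (n : nat) (X : manifold R n) (E : bundle X)
    (W : forall x, set (E x)) : (forall x, W x = [set 0]) -> subbundle W.
Proof.
move=> W0 x; exists void, (@of_void (section E)); split=> [[]|].
near=> y; split; last by move=> c c' _; apply/boolp.funext => -[].
rewrite W0; apply/seteqP; split=> [_ ->|_ [c _ <-]].
  by exists (fun=> 0) => //; rewrite big1 // => -[].
by rewrite big1 // => -[].
Unshelve. all: by end_near. Qed.

Section Holonomic.
Context {R : realType} {n : nat} {X : manifold R n}.
Variables (E : bundle X) (q : nat).
Hypothesis vbE : vector_bundle E.
Implicit Types (x y : X) (k l r s : nat).
Let linE := vector_bundle_linear vbE.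

(* The identity of [J_q(E)] as a differential operator of order [q] on [E]: its
   [r]-prolongation is the inclusion of [J_(q+r)(E)] in [J_r(J_q(E))]. *)
Definition jet_id x (u : jet_bundle q E x) : jet_bundle q E x := u.
Arguments jet_id : clear implicits.

Lemma jet_id_bundle_map : bundle_map jet_id.
Proof.
by split=> // t t' Et Et'; have [_ _] := jet_vector_bundle vbE q; exact.
Qed.

Lemma prolong_id_jet r x (s : section E) : smooth_section_at x s ->
  prolong r jet_id x (jet (q + r) s x) = jet r (jet q s : section (jet_bundle q E)) x.
Proof.
by move=> ss; exact: (prolong_jet vbE (jet_linear_bundle vbE (k:=q)) jet_id_bundle_map r ss).
Qed.

Lemma ker_prolong_id r x : ker_map (prolong r jet_id) x = [set 0].
Proof.
apply/seteqP; split=> [u|_ ->]; last first.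
  have linP : linear (prolong r jet_id x).
    exact: (prolong_linear vbE (jet_linear_bundle vbE (k:=q)) jet_id_bundle_map).
  exact: (linear_fun0 linP).
have su := smooth_qrepr linE u.
rewrite /ker_map /= -(jet_qrepr u) (prolong_id_jet r su).
move=> /(jet_zero (jet_linear_bundle vbE (k:=q)) _ (jet_smooth vbE su)) v0.
by apply/(jet_zero linE _ su); apply/(vanishes_jet vbE).
Qed.

Lemma vanishes_le k l x (s : section E) : (l <= k)%N -> smooth_section_at x s ->
  vanishes k x s -> vanishes l x s.
Proof.
move=> lk ss /(vanishesP _ ss) vs; apply/(vanishesP _ ss) => t Et tx i c ac cx.
exact: flat_at_le lk (vs t Et tx i c ac cx).
Qed.

Lemma jet_proj0 k l x : (l <= k)%N -> jet_proj l (0 : jet_bundle k E x) = 0.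
Proof.
move=> lk; have s0 : smooth_section_at x (0 : section E) by exact: smooth_section0.
have sq := smooth_qrepr linE (0 : jet_bundle k E x).
apply/(jet_zero linE _ sq); apply: vanishes_le lk sq _.
by have := vanishes_qrepr linE (k := k) s0; rewrite subr0.
Qed.

End Holonomic.

(** All prolongations of the identity are injective, so every family in the regularity condition is
    the zero subbundle. *)
Lemma jet_id_regular (R : realType) (n : nat) (X : manifold R n) (E : bundle X) q :
  vector_bundle E -> regular (@jet_id R n X E q).
Proof.
move=> vbE r s; split.
  by apply: subbundle_zero => x; exact: ker_prolong_id.
apply: subbundle_zero => x; rewrite /proj_kernel (ker_prolong_id q vbE) image_set1.
by rewrite jet_proj0 // leq_add2l leq_addr.
Qed.

(** * The real line and its trivial line bundle *)

Section RealLine.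
Context {R : realType}.
Notation V := 'rV[R]_1.

Lemma row1_second_countable : @second_countable V.
Proof.
pose B (pq : rat * rat) : set V := [set a | ratr pq.1 < a 0 0 < ratr pq.2].
exists (range B); first exact: sub_countable (card_image_le _ _) (countableP _).
split=> [_ [pq _ <-]|a P].
  have cont : continuous (fun a : V => a 0 0) by move=> a; exact: coord_continuous.
  have -> : B pq = (fun a : V => a 0 0) @^-1` `]ratr pq.1, ratr pq.2[%classic.
    by apply/seteqP; split=> a; rewrite /B /= in_itv.
  by apply: open_comp; [move=> a _; exact: cont|exact: interval_open].
move=> /nbhs_ballP[e /= e0 aP].
have h1 : a 0 0 - e < a 0 0 by rewrite ltrBlDr ltrDl.
have h2 : a 0 0 < a 0 0 + e by rewrite ltrDl.
have [p Hp] := rat_in_itvoo h1; have [q' Hq] := rat_in_itvoo h2.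
rewrite in_itv /= in Hp; rewrite in_itv /= in Hq.
case/andP: Hp => p1 p2; case/andP: Hq => q1 q2.
exists (B (p, q')); first by split; [exists (p, q')|rewrite /B /= p2 q1].
move=> b /= /andP[b1 b2]; apply: aP; split=> // i j; rewrite !ord1.
by rewrite /ball /= ltr_distlC (lt_trans p1 b1) (lt_trans b2 q2).
Qed.

Definition line_chart : @chart R 1 V := Chart setT id id.

Lemma line_is_chart : is_chart line_chart.
Proof.
split=> //=; first exact: openT.
- by rewrite image_id; exact: openT.
- by move=> x _; exact: cvg_id.
- by move=> x _; exact: cvg_id.
Qed.

Lemma line_cover (x : V) : exists2 c, [set line_chart] c & cdom c x.
Proof. by exists line_chart. Qed.

Lemma line_compatible (c c' : chart V) :
  [set line_chart] c -> [set line_chart] c' -> compatible c c'.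
Proof. by move=> -> -> x _ _ i; exact: smooth_at_coord. Qed.

Definition line : manifold R 1 :=
  @Manifold R 1 V [set line_chart]
    (fun c (H : c = line_chart) => eq_ind_r (@is_chart R 1 V) line_is_chart H)
    line_cover line_compatible (@norm_hausdorff R V) row1_second_countable.

Definition scalar_triv : trivialization (fun _ : line => R^o : lmodType R) :=
  @Trivialization R 1 line (fun=> R^o) unit setT (fun x e _ => e).

Definition scalars : bundle line := @Bundle R 1 line (fun=> R^o) (fun t => t = scalar_triv).

Lemma scalars_vector_bundle : vector_bundle scalars.
Proof.
split=> [_ ->|x|_ _ -> ->]; last 2 first.
- by exists scalar_triv.
- exists (fun _ _ _ => 1) => x _ _; split=> [_ _|e []]; first exact: smooth_fun_cst.
  by rewrite (bigD1 tt) //= big1 ?addr0 ?mul1r // => -[].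
split=> [|x _]; first exact: openT.
split=> [i a u v //|]; exists (fun c => c tt) => // c; apply/boolp.funext => -[] //.
Qed.

End RealLine.

Section Nonholonomic.
Context {R : realType} {n : nat} {X : manifold R n}.
Variables (E : bundle X).
Hypothesis vbE : vector_bundle E.
Implicit Types (x y : X).
Let linE := vector_bundle_linear vbE.

Lemma smooth_sectionZ x (h : X -> R) (s : section E) : smooth_fun_at x h ->
  smooth_section_at x s -> smooth_section_at x ((fun y => h y *: s y) : section E).
Proof.
move=> sh ss t Et tx i; apply: smooth_fun_eq (smooth_funM sh (ss t Et tx i)).
by apply: filterS (tdom_near (linE Et) tx) => y ty; rewrite (tmapZ (linE Et) ty).
Qed.

Lemma jet0_eq x (s s' : section E) : smooth_section_at x s -> smooth_section_at x s' ->
  s x = s' x -> jet 0 s x = jet 0 s' x.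
Proof.
move=> ss ss' E'; apply/(jet_eq linE) => //; have sB := smooth_sectionB linE ss ss'.
apply/(vanishesP _ sB) => t Et tx i c ac cx; apply/flat_at0 => /=.
by rewrite (cmapK ac cx) -[X in tmap t X]/(s x - s' x) E' subrr (tmap0 (linE Et) tx).
Qed.

End Nonholonomic.

(** A 0-jet is determined by the value of the section, and every value in [J_q(E)] is the jet of
    some section of [E]. So the order 0 prolongation of the identity is onto and its cokernel is
    zero. *)
Lemma ker_prolong_coker_id (R : realType) (n : nat) (X : manifold R n) (E : bundle X) q x
    (s : section (jet_bundle q E)) : vector_bundle E -> smooth_section_at x s ->
  ker_map (prolong 1 (coker_proj (prolong 0 (@jet_id R n X E q)))) x (jet (0 + 1)%N s x).
Proof.
move=> vbE ss; have vbJ := jet_vector_bundle vbE q.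
have linE := vector_bundle_linear vbE; have linJ := vector_bundle_linear vbJ.
have bid := jet_id_bundle_map q vbE.
have E1 := @prolong_coker_jet R n X E (jet_bundle q E) q (@jet_id R n X E q) vbJ 0 x s ss.
apply: (etrans E1).
have linQ := coker_linear_bundle (f := prolong 0 (@jet_id R n X E q)).
apply/(jet_zero linQ); first exact: coker_jet_smooth.
have H : \forall y \near x, (0 : section (coker (prolong 0 (@jet_id R n X E q)))) y =
    coker_proj (prolong 0 (@jet_id R n X E q)) y (jet 0 s y).
  apply: filterS (smooth_section_near vbJ ss) => y sy.
  apply/esym/coker_proj_eq0.
    by move=> z; exact: (prolong_linear vbE linJ bid).
  (* The preimage is chosen separately at each [y]; the field [s] itself may fail to be the jet of
     one section. *)
  have sq := smooth_qrepr linE (s y).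
  refine (ex_intro2 _ _ (jet (q + 0)%N (qrepr (s y)) y) I _).
  apply: (etrans (prolong_id_jet q vbE 0 sq)).
  exact: (jet0_eq vbJ (jet_smooth vbE sq) sy (jet_qrepr (s y))).
apply: (vanishes_eq _ H); first exact: smooth_section0.
exact: vanishes0.
Qed.

Section NonholonomicJet.
Context {R : realType}.
Notation E := (@scalars R).
Notation V := 'rV[R]_1.

Let one : section E := fun=> 1.

Lemma scalars_smooth (x : line) (h : V -> R) : smooth_at x h ->
  smooth_section_at x (h : section E).
Proof. by move=> sh _ -> _ [] _ -> _. Qed.

(* The 1-jet at [x] of the field of 1-jets with value [y] and slope [0] at [y]: the
   value component forces the slope to be [1]. *)
Lemma nonholonomic (x : line) (s : section E) : smooth_section_at x s ->
  ~ vanishes 1 x (((fun y : line => (y : V) 0 0 *: jet 1 one y) : section (jet_bundle 1 E))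
    - jet 1 s).
Proof.
move=> ss vs; have vbE := @scalars_vector_bundle R.
have linE := vector_bundle_linear vbE.
have vbJ := jet_vector_bundle vbE 1; have linJ := vector_bundle_linear vbJ.
have s1 : smooth_section_at x one by apply: scalars_smooth; exact: smooth_at_cst.
have sh : smooth_fun_at x (fun y : line => (y : V) 0 0) by move=> _ -> _; exact: smooth_at_coord.
have sd := smooth_sectionB linJ (smooth_sectionZ vbJ sh (jet_smooth vbE (k := 1) s1))
  (jet_smooth vbE (k := 1) ss).
pose tau : V -> R := s.
have stau : smooth_at (x : V) tau by exact: (ss (scalar_triv) erefl I tt line_chart erefl I).
(* The empty word gives the value component of the difference of the two fields, a single letter its
   slope component; [multi_word_onto] translates words into jet coordinates. *)
have flat w : (size w <= 1)%N ->
    flat_at 1 (x : V) (fun b : V => b 0 0 * dword w (fun=> 1) b - dword w tau b).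
  move=> w1; have [alpha wa] := multi_word_onto w1.
  pose T := @jet_triv R 1 line 1 E scalar_triv line_chart.
  have ET : trivs (jet_bundle 1 E) T by exists scalar_triv, line_chart.
  have ff := (vanishesP 1 sd).1 vs T ET (conj I I) (alpha, tt) line_chart erefl I.
  apply: flat_at_eq ff; near=> b.
  have oneb : smooth_section_at (b : line) one by apply: scalars_smooth; exact: smooth_at_cst.
  have sb : smooth_section_at (b : line) s by near: b; exact: (smooth_section_near vbE ss).
  have TT := linJ T ET.
  have taub : smooth_at (b : V) tau by near: b; exact: smooth_at_near.
  have dE (h : V -> R) : smooth_at b h -> dmulti alpha h b = dword w h b.
    by move=> hb; rewrite dmulti_word (nbhs_singleton (dword_perm hb wa)).
  have tB := tmapB TT (conj I I) (b 0 0 *: jet 1 one (b : line)) (jet 1 s (b : line)) (alpha, tt).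
  have tZ := tmapZ TT (conj I I) (b 0 0) (jet 1 one (b : line)) (alpha, tt).
  have t1 := etrans (@jet_coord R 1 line E 1 scalar_triv line_chart one (alpha, tt) b
    linE erefl I erefl I oneb)
    (dE (fun=> 1) (smooth_at_cst b 1)).
  have ts := etrans (@jet_coord R 1 line E 1 scalar_triv line_chart s (alpha, tt) b
    linE erefl I erefl I sb) (dE tau taub).
  apply: (etrans tB); apply: (etrans (congr1 (fun z => z - _) tZ)).
  exact: (congr2 (fun u v => b 0 0 * u - v) t1 ts).
(* To first order at [x], the value component says that [tau] has derivative 1; to order 0, the
   slope component says that this derivative is 0. *)
have /flat_atS[_ /(_ ord0)/flat_at0] := flat [::] isT.
have /flat_at0 := flat_at_le (leq0n 1) (flat [:: ord0] isT).
rewrite /= partial_cst mulr0 sub0r => /eqP; rewrite oppr_eq0 => /eqP dtau.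
have sc := smooth_atM (smooth_at_coord ord0 x) (smooth_at_cst x 1).
have sm := smooth_atM (smooth_at_cst x (-1)) stau.
have -> : (fun b : V => b 0 0 * 1 - tau b) = fun b : V => b 0 0 * 1 + -1 * tau b.
  by apply/boolp.funext => b; rewrite mulN1r.
rewrite partialD // !partialM ?partial_cst ?partial_coord //;
  do ?[exact: smooth_at_cst|exact: smooth_at_coord].
rewrite dtau !mulr0 !addr0 add0r mul1r => /eqP.
by rewrite oner_eq0.
Unshelve. all: by end_near. Qed.

End NonholonomicJet.

(** The separating element is the jet of the field from [nonholonomic]. It lies in the larger kernel
    because the cokernel at order 0 is zero; a preimage under the first prolongation would make the
    field agree to first order with [jet 1] of a section. *)
Lemma jet_id_not_exact (R : realType) (x : @line R) :
  let Phi := @jet_id R 1 line scalars 1 in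
  ker_map (coker_proj (prolong (0 + 1)%N Phi)) x <>
  ker_map (prolong 1 (coker_proj (prolong 0 Phi))) x.
Proof.
move=> Phi; have vbE := @scalars_vector_bundle R.
have vbJ := jet_vector_bundle vbE 1; have linE := vector_bundle_linear vbE.
have s1 : smooth_section_at x ((fun=> 1) : section (@scalars R)).
  by apply: scalars_smooth; exact: smooth_at_cst.
have sh : smooth_fun_at x (fun y : line => (y : 'rV[R]_1) 0 0).
  by move=> _ -> _; exact: smooth_at_coord.
have sj := smooth_sectionZ vbJ sh (jet_smooth vbE (k := 1) s1).
have := ker_prolong_coker_id vbE sj => /[swap] <-.
rewrite (ker_coker_prolong vbE vbJ (jet_id_bundle_map 1 vbE)) => -[w _].
have sw := smooth_qrepr linE w.
rewrite -(jet_qrepr w) => E1.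
have /esym := etrans (esym (prolong_id_jet 1 vbE (0 + 1)%N sw)) E1.
move=> /(jet_eq (vector_bundle_linear vbJ) _ sj (jet_smooth vbE sw)).
exact: nonholonomic.
Qed.

Local Close Scope ring_scope.

Theorem proposition3p1 (R : realType) :
  (forall (n : nat) (X : manifold R n) (E F0 : bundle X) (q : nat)
          (Phi : forall x : X, jet_bundle q E x -> F0 x),
    vector_bundle E -> vector_bundle F0 -> bundle_map Phi -> regular Phi ->
    forall (r : nat) (x : X),
      let B r := im_map (prolong r Phi) in
      let Psi r := coker_proj (prolong r Phi) in
      [/\ B (r + 1)%N x = range (prolong (r + 1) Phi x),
          range (prolong (r + 1) Phi x) = ker_map (Psi (r + 1)%N) x,
          ker_map (Psi (r + 1)%N) x `<=` ker_map (prolong 1 (Psi r)) x &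
          ker_map (prolong 1 (Psi r)) x = prolong_sub (B r) x])
  /\
  (exists (n : nat) (X : manifold R n) (E F0 : bundle X) (q : nat)
          (Phi : forall x : X, jet_bundle q E x -> F0 x),
    [/\ vector_bundle E, vector_bundle F0, bundle_map Phi, regular Phi &
        exists (r : nat) (x : X),
          ker_map (coker_proj (prolong (r + 1) Phi)) x <>
          ker_map (prolong 1 (coker_proj (prolong r Phi))) x]).
Proof.
split=> [n X E F0 q Phi vbE vbF bPhi regPhi r x B Psi|].
  split.
  - by [].
  - by apply/esym; exact: ker_coker_prolong.
  - exact: ker_coker_sub_ker_prolong.
  - by apply: ker_prolong_coker => //; have [] := regPhi r 0%N.
exists 1%N, line, scalars, (jet_bundle 1 scalars), 1%N, (@jet_id R 1 line scalars 1).
have vbE := @scalars_vector_bundle R.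
apply: And5.
- exact: vbE.
- exact: jet_vector_bundle.
- exact: jet_id_bundle_map.
- exact: jet_id_regular.
- by exists 0%N, (0%R : 'rV[R]_1); exact: jet_id_not_exact.
Qed.
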